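(* Let $q$ be a fixed positive integer. There is an algorithm that, given a hypergraph $\mathcal H$ and a positive integer $p$, decides whether $\mathcal H$ is $(p,q)$-Helly in (i) $O(M)$ time if $p=1$; (ii) $O\bigl((rN+M)\binom Np\bigr)$ time if $p\geq 2$, where $N=\binom nq$. In particular, if $p$ and $q$ are both fixed, bound (ii) becomes $O(rn^{(p+1)q}+Mn^{pq})$.
   Context: A hypergraph $\mathcal H$ is a pair $(X,\mathcal E)$ with $X$ a finite set and $\mathcal E$ a finite family of nonempty subsets of $X$ (edges) whose union is $X$. The core of a family of sets is the intersection of its members. A family is $(p,q)$-intersecting if every nonempty subfamily of at most $p$ members has core of cardinality at least $q$; a hypergraph is $(p,q)$-Helly if every nonempty $(p,q)$-intersecting subfamily of its edge family has core of cardinality at least $q$. In the bounds, $n$ is the number of vertices, $r$ the maximum cardinality of an edge and $M$ the sum of the cardinalities of all edges of $\mathcal H$; constants hidden in the $O$-notation may depend on $q$. *)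

(* Defs.v *)
From mathcomp Require Import all_boot.

Set Implicit Arguments.
Unset Strict Implicit.
Unset Printing Implicit Defensive.

(** * Hypergraphs *)

(* The edges form an indexed family, so repeated edges are allowed; a
   subfamily is a set of indices. *)
Record hypergraph := Hypergraph {
  vertex : finType;
  nedges : nat;
  edge : 'I_nedges -> {set vertex};
  edge_neq0 : forall i, edge i != set0;
  edge_cover : \bigcup_i edge i = [set: vertex] }.

Definition core (H : hypergraph) (J : {set 'I_(nedges H)}) : {set vertex H} :=
  \bigcap_(i in J) edge i.

Definition intersecting (p q : nat) (H : hypergraph)
    (J : {set 'I_(nedges H)}) : bool :=
  [forall K : {set 'I_(nedges H)},
     [&& K != set0, K \subset J & #|K| <= p] ==> (q <= #|core K|)].

Definition helly (p q : nat) (H : hypergraph) : bool :=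
  [forall J : {set 'I_(nedges H)},
     (J != set0) && intersecting p q J ==> (q <= #|core J|)].

Definition nvertices (H : hypergraph) : nat := #|vertex H|.
Definition rank (H : hypergraph) : nat := \max_i #|edge (h := H) i|.
Definition total_size (H : hypergraph) : nat := \sum_i #|edge (h := H) i|.

(** * Random-access machine *)

(* Programs over finitely many registers and a random-access memory, whose
   cells all hold natural numbers. Every node of an expression and every
   executed command or test costs one time unit. Subtraction is truncated. *)
Inductive binop := Add | Sub | Mul.

Inductive expr :=
  | Const of nat
  | Reg of nat
  | Read of expr
  | Bin of binop & expr & expr.

Inductive cmd :=
  | Skip
  | Assign of nat & expr
  | Write of expr & expr
  | Seq of cmd & cmd
  | If of expr & cmd & cmd
  | While of expr & cmd.

Record state := State { reg : nat -> nat; mem : nat -> nat }.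

Definition update (f : nat -> nat) (a v : nat) : nat -> nat :=
  fun b => if b == a then v else f b.

Definition binop_eval (o : binop) : nat -> nat -> nat :=
  match o with Add => addn | Sub => subn | Mul => muln end.

Fixpoint eval (s : state) (e : expr) : nat :=
  match e with
  | Const k => k
  | Reg x => reg s x
  | Read a => mem s (eval s a)
  | Bin o e1 e2 => binop_eval o (eval s e1) (eval s e2)
  end.

(* Every value arising in the evaluation of [e], addresses included, fits in
   a machine word, i.e. is less than [W]. *)
Fixpoint fits (W : nat) (s : state) (e : expr) : bool :=
  (eval s e < W) &&
  match e with
  | Const _ | Reg _ => true
  | Read a => fits W s a
  | Bin _ e1 e2 => fits W s e1 && fits W s e2
  end.

Fixpoint cost (e : expr) : nat :=
  match e with
  | Const _ | Reg _ => 1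
  | Read a => (cost a).+1
  | Bin _ e1 e2 => (cost e1 + cost e2).+1
  end.

(* [exec W c s s' t]: on a machine with word bound [W], the command [c]
   started in [s] halts in [s'] after [t] time units. A program that
   overflows is stuck: [exec] does not hold for any [s'] and [t]. *)
Inductive exec (W : nat) : cmd -> state -> state -> nat -> Prop :=
  | ExecSkip s : exec W Skip s s 1
  | ExecAssign s x e :
      fits W s e ->
      exec W (Assign x e) s (State (update (reg s) x (eval s e)) (mem s))
        (cost e).+1
  | ExecWrite s a e :
      fits W s a -> fits W s e ->
      exec W (Write a e) s (State (reg s) (update (mem s) (eval s a) (eval s e)))
        (cost a + cost e).+1
  | ExecSeq s s1 s2 c1 c2 t1 t2 :
      exec W c1 s s1 t1 -> exec W c2 s1 s2 t2 ->
      exec W (Seq c1 c2) s s2 (t1 + t2)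
  | ExecIfTrue s s1 e c1 c2 t :
      fits W s e -> eval s e != 0 -> exec W c1 s s1 t ->
      exec W (If e c1 c2) s s1 (cost e + t).+1
  | ExecIfFalse s s1 e c1 c2 t :
      fits W s e -> eval s e == 0 -> exec W c2 s s1 t ->
      exec W (If e c1 c2) s s1 (cost e + t).+1
  | ExecWhileDone s e c :
      fits W s e -> eval s e == 0 ->
      exec W (While e c) s s (cost e).+1
  | ExecWhileStep s s1 s2 e c t1 t2 :
      fits W s e -> eval s e != 0 ->
      exec W c s s1 t1 -> exec W (While e c) s1 s2 t2 ->
      exec W (While e c) s s2 (cost e + t1 + t2).+1.

(** * Running a program on a hypergraph *)

(* An input lists the vertices of each edge, without repetition and in an
   arbitrary order. *)
Definition edge_listing (H : hypergraph)
    (l : 'I_(nedges H) -> seq (vertex H)) : Prop :=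
  forall i, uniq (l i) /\ l i =i edge i.

(* Vertices are numbered from 0 by [enum_rank]. *)
Definition encode (p : nat) (H : hypergraph)
    (l : 'I_(nedges H) -> seq (vertex H)) : seq nat :=
  [:: p, nvertices H, nedges H &
      flatten [seq size (l i) :: [seq nat_of_ord (enum_rank x) | x <- l i]
              | i <- enum 'I_(nedges H)]].

Definition initial_state (w : seq nat) : state :=
  State (fun _ => 0) (nth 0 w).

(* [alg] decides whether [H] is (p,q)-Helly, leaving the answer in register 0,
   in time O(f p H) over all inputs with [P p].
   - O(f) is read as "at most c * (f + 1)", because f may vanish (for instance
     'C(N, p) = 0 when N < p) whereas every run takes at least one step.
   - Machine words have O(log(s + f)) bits, where s = p + n + M dominates the
     numbers in the input and its length up to a constant; this keeps the
     unit-cost arithmetic, multiplication in particular, realistic. *)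
Definition decides_helly_in_time_O (alg : cmd) (q : nat) (P : nat -> Prop)
    (f : nat -> hypergraph -> nat) : Prop :=
  exists c d : nat,
    forall (p : nat) (H : hypergraph) (l : 'I_(nedges H) -> seq (vertex H)),
      P p -> edge_listing l ->
      exists (s : state) (t : nat),
        [/\ exec ((p + nvertices H + total_size H + f p H + 2) ^ d) alg
              (initial_state (encode p l)) s t,
            reg s 0 = nat_of_bool (helly p q H)
          & t <= c * (f p H).+1].

(* Main.v *)
(* Call a set of p + 1 distinct q-subsets of vertices bad if some edge contains
   all of them but at most one, and if the edges with this property have a core
   of size < q. The hypergraph is (p,q)-Helly iff no set is bad: any p of these
   edges miss at most p of the q-subsets, hence share one; conversely, in a
   minimal (p,q)-intersecting family with small core, pick for p + 1 edges e a
   q-subset of the core of the other edges.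

   Let N = 'C(n, q), and for p q-subsets T let E_T be the family of the edges
   containing all of them. The edges attached to a set S of p + 1 q-subsets are
   the union of the E_T over T = S minus one element. For each T the program
   tabulates in time O(M) the size of E_T and the degrees of the vertices in
   E_T, at a row given by the rank of T in colexicographic order. For each S it
   then reads off the size of the core along any one edge, in time O(r(p + 1)):
   in total r(p + 1) 'C(N, p + 1) = r(N - p) 'C(N, p). If p >= N there are no
   p + 1 distinct q-subsets and the answer is yes; this is detected in O(1). For
   p = 1 it suffices to look at the core of the edges of size >= q. *)

Require Import Defs.
From mathcomp Require Import all_boot zify.

Set Implicit Arguments.
Unset Strict Implicit.
Unset Printing Implicit Defensive.

(** * Programs *)

(** The time allotted to one set S does not depend on M, so the core of a union of families has to
    come from tables. This works because a vertex lies in all edges of a family exactly when its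
    degree there equals the size of the family, and because degrees of several families can be
    compared row by row without forming their union. The same budget must also yield the p + 1 row
    numbers of S: removing the next element instead of the current one changes a single term of the
    colexicographic rank, so a table of binomial coefficients gives each number from the previous
    one in constant time. Word size is the other constraint. Pascal's triangle is cut down to a band
    whose entries never exceed C(N, p), and N itself is obtained by counting. No table is ever
    cleared: memory beyond the input starts at 0 and each family owns its slice. Overlaps among the
    q-subsets of T are harmless since inclusion in an edge is tested by counting vertices with
    multiplicity. *)

Local Notation "# k" := (Const k) (at level 1, format "# k").
Local Notation "$ x" := (Reg x) (at level 1, format "$ x").
Local Notation "a |+| b" := (Bin Add a b) (at level 50, left associativity).
Local Notation "a |-| b" := (Bin Defs.Sub a b) (at level 50, left associativity).
Local Notation "a |*| b" := (Bin Mul a b) (at level 40, left associativity).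
Local Notation "c1 ;; c2" := (Seq c1 c2) (at level 90, right associativity).

(* MathComp's [mem] and [Sub] shadow those of [Defs]. *)
Local Notation ram := Defs.mem.
Local Notation rAns := 0 (only parsing).
Local Notation rBase := 1 (only parsing).

(* Eight unbounded arrays are interleaved beyond the input: cell [i] of the array
   with code [k] is at address [base + (8 * i + k)]. Rows of [Mult] and [Cnt]
   have width [n]. Row [r] of [Cnt], [Tot] and [Ptr] describes a family of edges:
   the degrees of the vertices, the size of the family, and the address in the
   input of one of its edges (0 if it is empty). *)
Inductive aname := Mult | Cnt | Tot | Ptr | Subset | Comb | Row | Binom.
Definition acode (k : aname) : nat :=
  match k with
  | Mult => 0 | Cnt => 1 | Tot => 2 | Ptr => 3
  | Subset => 4 | Comb => 5 | Row => 6 | Binom => 7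
  end.
Definition asame (k k' : aname) : bool := acode k == acode k'.

Arguments asame !k !k' /.

Definition addr (k : aname) (e : expr) : expr :=
  $rBase |+| (#8 |*| e |+| #(acode k)).
Definition cell (k : aname) (e : expr) : expr := Read (addr k e).

Lemma acode_lt k : acode k < 8. Proof. by case: k. Qed.

Fixpoint modR (c : cmd) : seq nat :=
  match c with
  | Assign x _ => [:: x]
  | Seq c1 c2 | If _ c1 c2 => modR c1 ++ modR c2
  | While _ c1 => modR c1
  | _ => [::]
  end.

(** A syntactic match on the expressions built by [addr], so that the arrays a command may modify
    are computable from its text. *)
Definition addr_code (a : expr) : option nat :=
  if a is Bin Add (Reg b) (Bin Add (Bin Mul (Const c) _) (Const k)) then
    if [&& b == rBase, c == 8 & k < 8] then Some k else None
  else None.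

Fixpoint modA (c : cmd) : seq nat :=
  match c with
  | Write a _ => if addr_code a is Some k then [:: k] else [::]
  | Seq c1 c2 | If _ c1 c2 => modA c1 ++ modA c2
  | While _ c1 => modA c1
  | _ => [::]
  end.

(** Writes of this shape, with a base register that is never assigned, only reach cells from the
    base onwards; this protects the input. *)
Fixpoint wf (c : cmd) : bool :=
  match c with
  | Assign x _ => x != rBase
  | Write a _ => isSome (addr_code a)
  | Seq c1 c2 | If _ c1 c2 => wf c1 && wf c2
  | While _ c1 => wf c1
  | Skip => true
  end.

Lemma addr_codeP a k : addr_code a = Some k ->
  k < 8 /\ exists e, a = $rBase |+| (#8 |*| e |+| #k).
Proof.
case: a => //= -[] // [] // x [] // [] // [] // [] // [] // c e [] // k' /=.
by case: ifP => // /and3P[/eqP-> /eqP-> lt8] [<-]; split=> //; exists e.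
Qed.

(* Time is counted in loop iterations, and only the values that are stored are
   required to be below [B]: [run_exec] recovers the time and the word bound
   of [exec] up to a constant factor and a constant power. *)
Inductive run (B : nat) : cmd -> state -> state -> nat -> Prop :=
  | RunSkip s : run B Skip s s 0
  | RunAssign s x e : eval s e < B ->
      run B (Assign x e) s (State (update (reg s) x (eval s e)) (ram s)) 0
  | RunWrite s a e : eval s e < B ->
      run B (Write a e) s
        (State (reg s) (update (ram s) (eval s a) (eval s e))) 0
  | RunSeq s s1 s2 c1 c2 t1 t2 :
      run B c1 s s1 t1 -> run B c2 s1 s2 t2 -> run B (c1 ;; c2) s s2 (t1 + t2)
  | RunIfTrue s s1 e c1 c2 t :
      eval s e != 0 -> run B c1 s s1 t -> run B (If e c1 c2) s s1 t
  | RunIfFalse s s1 e c1 c2 t :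
      eval s e == 0 -> run B c2 s s1 t -> run B (If e c1 c2) s s1 t
  | RunWhileDone s e c : eval s e == 0 -> run B (While e c) s s 0
  | RunWhileStep s s1 s2 e c t1 t2 :
      eval s e != 0 -> run B c s s1 t1 -> run B (While e c) s1 s2 t2 ->
      run B (While e c) s s2 (t1 + t2).+1.

Definition bounded (B : nat) (s : state) : Prop :=
  (forall x, reg s x < B) /\ (forall a, ram s a < B).

(** Exponent of [B] in a bound for the value: [k < B ^ k.+1] whenever [B > 1], and exponents add up
    under both sums and products. *)
Fixpoint esize (e : expr) : nat :=
  match e with
  | Const k => k.+1
  | Reg _ => 1
  | Read a => (esize a).+1
  | Bin _ a b => esize a + esize b
  end.

Fixpoint width (c : cmd) : nat :=
  match c with
  | Skip => 0
  | Assign _ e => esize e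
  | Write a e => esize a + esize e
  | Seq c1 c2 => width c1 + width c2
  | If e c1 c2 => esize e + width c1 + width c2
  | While e c1 => esize e + width c1
  end.

Fixpoint duration (c : cmd) : nat :=
  match c with
  | Skip => 1
  | Assign _ e => (cost e).+1
  | Write a e => (cost a + cost e).+1
  | Seq c1 c2 => duration c1 + duration c2
  | If e c1 c2 => (cost e + duration c1 + duration c2).+1
  | While e c1 => (cost e + duration c1).+1
  end.

Lemma esize_gt0 e : 0 < esize e.
Proof. by elim: e => //= _ a; lia. Qed.

Lemma eval_lt_pow B s e : 1 < B -> bounded B s -> eval s e < B ^ esize e.
Proof.
move=> B_gt1 [ltR ltM]; have B_gt0 := ltnW B_gt1.
have powM a b x : x < B ^ a -> x < B ^ (a + b).
  by move=> /leq_trans; apply; rewrite leq_pexp2l ?leq_addr.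
elim: e => [k|x|a _|o a IHa b IHb] /=.
- by apply: leq_trans (ltn_expl k B_gt1) _; rewrite leq_pexp2l.
- by rewrite expn1.
- by rewrite -[(esize a).+1]add1n; apply: powM; rewrite expn1.
have := esize_gt0 a; have := esize_gt0 b.
case: o => /= _ _.
- rewrite expnD; nia.
- by apply: leq_ltn_trans (leq_subr _ _) (powM _ _ _ IHa).
- by rewrite expnD ltn_mul.
Qed.

Lemma fits_pow B W s e : 1 < B -> bounded B s -> B ^ esize e <= W -> fits W s e.
Proof.
move=> B_gt1 bs; have B_gt0 := ltnW B_gt1.
elim: e => [k|x|a IHa|o a IHa b IHb] leW /=;
  rewrite (leq_trans (eval_lt_pow _ B_gt1 bs) leW) //=.
- by apply: IHa; apply: leq_trans leW; rewrite leq_pexp2l //=.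
- rewrite IHa ?IHb //; apply: leq_trans leW; rewrite leq_pexp2l //= ?leq_addr //.
  exact: leq_addl.
Qed.

Lemma bounded_run B c s s' k : run B c s s' k -> bounded B s -> bounded B s'.
Proof.
elim=> {c s s' k} //; try by move=> *; auto.
- by move=> s x e lt [ltR ltM]; split=> //= y; rewrite /update; case: ifP.
- by move=> s x e lt [ltR ltM]; split=> //= y; rewrite /update; case: ifP.
Qed.

(** Charge every step to the innermost loop iteration around it, or to the part outside all loops.
    Each of these [k.+1] portions executes any piece of the text at most once, hence costs at most
    [duration c]. *)
Lemma run_exec B W c s s' k : 1 < B -> bounded B s -> run B c s s' k ->
  B ^ width c <= W ->
  exists2 t, exec W c s s' t & t <= duration c * k.+1.
Proof.
move=> B_gt1 + rn; have B_gt0 := ltnW B_gt1.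
have leP a b : a <= b -> B ^ b <= W -> B ^ a <= W.
  by move=> le_ab; apply: leq_trans; rewrite leq_pexp2l.
elim: rn => {c s s' k} /=.
- by move=> s bs _; exists 1 => //; constructor.
- move=> s x e _ bs le; exists (cost e).+1; last by rewrite muln1.
  by constructor; apply: fits_pow bs _.
- move=> s a e _ bs le; exists (cost a + cost e).+1; last by rewrite muln1.
  constructor; apply: fits_pow bs _ => //; apply: leP le; first exact: leq_addr.
  exact: leq_addl.
- move=> s s1 s2 c1 c2 k1 k2 rn1 IH1 rn2 IH2 bs le.
  have [|t1 x1 le1] := IH1 bs; first by apply: leP le; apply: leq_addr.
  have [||t2 x2 le2] := IH2; first exact: bounded_run rn1 bs.
    by apply: leP le; apply: leq_addl.
  by exists (t1 + t2); [apply: ExecSeq x1 x2 | nia].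
- move=> s s1 e c1 c2 k nz rn IH bs le.
  have [|t x lt] := IH bs; first by apply: leP le; lia.
  exists (cost e + t).+1; last by nia.
  by apply: ExecIfTrue => //; apply: fits_pow bs _ => //; apply: leP le; lia.
- move=> s s1 e c1 c2 k nz rn IH bs le.
  have [|t x lt] := IH bs; first by apply: leP le; lia.
  exists (cost e + t).+1; last by nia.
  by apply: ExecIfFalse => //; apply: fits_pow bs _ => //; apply: leP le; lia.
- move=> s e c z bs le; exists (cost e).+1; last by nia.
  by apply: ExecWhileDone => //; apply: fits_pow bs _ => //; apply: leP le; lia.
- move=> s s1 s2 e c k1 k2 nz rn1 IH1 rn2 IH2 bs le.
  have [|t1 x1 le1] := IH1 bs; first by apply: leP le; lia.
  have [||t2 x2 le2] := IH2 => //; first exact: bounded_run rn1 bs.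
  exists (cost e + t1 + t2).+1; last by nia.
  apply: ExecWhileStep x1 x2 => //.
  by apply: fits_pow bs _ => //; apply: leP le; lia.
Qed.

Lemma fits_leq W W' s e : W <= W' -> fits W s e -> fits W' s e.
Proof.
move=> leW; elim: e => [k|x|a IHa|o a IHa b IHb] /= /andP[lt ft];
  rewrite (leq_trans lt leW) //=.
- exact: IHa.
- by case/andP: ft => /IHa-> /IHb->.
Qed.

Lemma exec_leq W W' c s s' t : W <= W' -> exec W c s s' t -> exec W' c s s' t.
Proof.
move=> leW; have fit s0 e := @fits_leq W W' s0 e leW.
by elim=> *; econstructor; eauto.
Qed.

(** * Program logic: frames, and total correctness with a bound on iterations *)

Section Logic.

Variables B base : nat.

Definition contents (s : state) (k : aname) (i : nat) : nat :=
  ram s (base + (8 * i + acode k)).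
Definition setr (s : state) (x v : nat) : state :=
  State (update (reg s) x v) (ram s).
Local Notation arr := contents.
Definition seta (s : state) (k : aname) (i v : nat) : state :=
  State (reg s) (update (ram s) (base + (8 * i + acode k)) v).

Lemma reg_setr s x v y : reg (setr s x v) y = if y == x then v else reg s y.
Proof. by []. Qed.
Lemma ram_setr s x v : ram (setr s x v) = ram s.
Proof. by []. Qed.
Lemma arr_setr s x v k i : arr (setr s x v) k i = arr s k i.
Proof. by []. Qed.
Lemma reg_seta s k i v y : reg (seta s k i v) y = reg s y.
Proof. by []. Qed.
Lemma ram_seta s k i v a : a < base -> ram (seta s k i v) a = ram s a.
Proof. by move=> lt; rewrite /= /update; case: eqP => // eqa; lia. Qed.
Lemma arr_seta s k i v k' j :
  arr (seta s k i v) k' j = if asame k' k && (j == i) then v else arr s k' j.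
Proof.
rewrite /arr /= /update /asame; have := acode_lt k; have := acode_lt k'.
move=> lt' lt; have -> // : (base + (8 * j + acode k') == base + (8 * i + acode k)) =
  (acode k' == acode k) && (j == i) by lia.
Qed.

Lemma eval_cell s k e : reg s rBase = base ->
  eval s (cell k e) = arr s k (eval s e).
Proof. by rewrite /= => ->. Qed.

(** [rs] and [ks] are the registers and array codes that may change; the cells below [base], which
    hold the input, may not. *)
Definition framed (rs ks : seq nat) (s s' : state) : Prop :=
  [/\ forall x, x \notin rs -> reg s' x = reg s x,
      forall a, a < base -> ram s' a = ram s a
    & forall k i, acode k \notin ks -> arr s' k i = arr s k i].

Local Notation frame := framed.

Lemma frame_trans rs ks s1 s2 s3 :
  frame rs ks s1 s2 -> frame rs ks s2 s3 -> frame rs ks s1 s3.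
Proof.
move=> [r12 m12 a12] [r23 m23 a23].
by split=> [x xn|a lt|k i kn]; rewrite ?r23 ?m23 ?a23 ?r12 ?m12 ?a12.
Qed.

Lemma frame_sub rs ks rs' ks' s s' :
  {subset rs <= rs'} -> {subset ks <= ks'} ->
  frame rs ks s s' -> frame rs' ks' s s'.
Proof.
move=> sr sk [fr fm fa]; split=> // [x xn|k i kn].
  by apply: fr; apply: contra xn => /sr.
by apply: fa; apply: contra kn => /sk.
Qed.

Lemma frame_all rs ks rs' ks' s s' :
  all (fun x => x \in rs') rs && all (fun k => k \in ks') ks ->
  frame rs ks s s' -> frame rs' ks' s s'.
Proof. by case/andP=> /allP sr /allP sk; apply: frame_sub. Qed.

Lemma wf_modR c : wf c -> rBase \notin modR c.
Proof.
elim: c => //= [x e|c1 IH1 c2 IH2|e c1 IH1 c2 IH2].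
- by rewrite inE eq_sym.
- by rewrite mem_cat negb_or => /andP[/IH1-> /IH2->].
- by rewrite mem_cat negb_or => /andP[/IH1-> /IH2->].
Qed.

Lemma run_frame c s s' k : run B c s s' k -> wf c -> reg s rBase = base ->
  frame (modR c) (modA c) s s'.
Proof.
elim=> {c s s' k} //=.
- move=> s x e _ nx bs; split=> //= y.
  by rewrite inE /update => /negPf->.
- move=> s a e _; case E: addr_code => [k|] // _ bs.
  have [lt8 [i ->]] := addr_codeP E; split=> //= [b|k' j]; rewrite bs.
    by rewrite /update; case: eqP => // eqb; lia.
  rewrite inE /arr /= /update => /eqP kn; case: eqP => // eqa.
  have := acode_lt k'; lia.
- move=> s s1 s2 c1 c2 k1 k2 r1 IH1 r2 IH2 /andP[wf1 wf2] bs.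
  have f1 := IH1 wf1 bs.
  have f2 : frame (modR c2) (modA c2) s1 s2.
    by apply: IH2 wf2 _; case: f1 => -> //; apply: wf_modR.
  by apply: frame_trans (frame_sub _ _ f1) (frame_sub _ _ f2) => x;
    rewrite mem_cat => ->; rewrite ?orbT.
- move=> s s1 e c1 c2 k1 _ r1 IH1 /andP[wf1 wf2] bs.
  by apply: frame_sub (IH1 wf1 bs) => x; rewrite mem_cat => ->.
- move=> s s1 e c1 c2 k1 _ r1 IH1 /andP[wf1 wf2] bs.
  by apply: frame_sub (IH1 wf2 bs) => x; rewrite mem_cat => ->; rewrite orbT.
- move=> s s1 s2 e c k1 k2 nz r1 IH1 r2 IH2 wf1 bs.
  have f1 := IH1 wf1 bs; apply: (frame_trans f1); apply: (IH2 wf1).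
  by case: f1 => -> //; apply: wf_modR.
Qed.

Definition safe (s : state) : Prop := bounded B s /\ reg s rBase = base.

Local Notation ready := safe.

Lemma ready_setr s x v : x != rBase -> v < B -> ready s -> ready (setr s x v).
Proof.
move=> nx lt [[ltR ltM] eb]; split; last by rewrite reg_setr eq_sym (negPf nx).
by split=> // y; rewrite reg_setr; case: ifP.
Qed.

Lemma ready_seta s k i v : v < B -> ready s -> ready (seta s k i v).
Proof.
move=> lt [[ltR ltM] eb]; split=> //; split=> // a.
by rewrite /= /update; case: ifP.
Qed.

Definition runs (c : cmd) (Q : state -> Prop) (K : nat) (s : state) : Prop :=
  exists s' k, [/\ run B c s s' k, k <= K & Q s'].

Local Notation wp := runs.

Lemma wp_leq c Q K K' s : wp c Q K s -> K <= K' -> wp c Q K' s.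
Proof. by move=> [s' [k [r le Qs]]] le'; exists s', k; split=> //; apply: leq_trans le'. Qed.

Lemma wp_conseq c (Q Q' : state -> Prop) K s :
  wp c Q K s -> (forall s', Q s' -> Q' s') -> wp c Q' K s.
Proof. by move=> [s' [k [r le Qs]]] imp; exists s', k; split=> //; apply: imp. Qed.

(** Adds to any postcondition the frame computed from the text, so that specifications need only
    mention what a command changes. *)
Lemma wp_frame c Q K s : wf c -> ready s -> wp c Q K s ->
  wp c (fun s' => [/\ ready s', frame (modR c) (modA c) s s' & Q s']) K s.
Proof.
move=> wfc [bs eb] [s' [k [r le Qs]]]; exists s', k; split=> //.
have fr := run_frame r wfc eb; split=> //; split; first exact: bounded_run r bs.
by case: fr => -> //; apply: wf_modR.
Qed.

Lemma wp_skip (Q : state -> Prop) K s : Q s -> wp Skip Q K s.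
Proof. by move=> Qs; exists s, 0; split=> //; constructor. Qed.

Lemma wp_assign x e v (Q : state -> Prop) K s :
  eval s e = v -> v < B -> Q (setr s x v) -> wp (Assign x e) Q K s.
Proof. by move=> <- lt Qs; do 2!eexists; split; last exact: Qs; first constructor. Qed.

Lemma wp_write k e e' i v (Q : state -> Prop) K s : reg s rBase = base ->
  eval s e = i -> eval s e' = v -> v < B -> Q (seta s k i v) ->
  wp (Write (addr k e) e') Q K s.
Proof.
move=> eb <- <- lt Qs; do 2!eexists; split; [exact: RunWrite | by [] |].
by rewrite /= eb.
Qed.

Lemma wp_seq K1 K2 c1 c2 Q K s : K1 + K2 <= K ->
  wp c1 (wp c2 Q K2) K1 s -> wp (c1 ;; c2) Q K s.
Proof.
move=> leK [s1 [k1 [r1 le1 [s2 [k2 [r2 le2 Qs]]]]]].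
by exists s2, (k1 + k2); split=> //; [apply: RunSeq r1 r2 | lia].
Qed.

Lemma wp_seq0 c1 c2 Q K s : wp c1 (wp c2 Q K) 0 s -> wp (c1 ;; c2) Q K s.
Proof. exact: wp_seq. Qed.

Lemma wp_if e c1 c2 Q K s :
  (eval s e != 0 -> wp c1 Q K s) -> (eval s e = 0 -> wp c2 Q K s) ->
  wp (If e c1 c2) Q K s.
Proof.
move=> Q1 Q2; case: (eqVneq (eval s e) 0) => [z|nz].
  have [s' [k [r le Qs]]] := Q2 z; exists s', k; split=> //.
  by apply: RunIfFalse => //; apply/eqP.
have [s' [k [r le Qs]]] := Q1 nz; exists s', k; split=> //.
exact: RunIfTrue.
Qed.

(** A counted loop: the invariant is indexed by the number of iterations made, and the guard must
    hold exactly while this number is below [n]. The frame relative to the entry state [s0] comes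
    for free, so invariants need not record what the body leaves alone. *)
Lemma wp_while n (Inv : nat -> state -> Prop) (K : nat -> nat) e c Q s0 :
  wf c -> ready s0 -> Inv 0 s0 ->
  (forall i s, i <= n -> ready s -> frame (modR c) (modA c) s0 s -> Inv i s ->
     (eval s e != 0) = (i < n) /\ (i < n -> wp c (Inv i.+1) (K i) s)) ->
  (forall s, ready s -> frame (modR c) (modA c) s0 s -> Inv n s -> Q s) ->
  wp (While e c) Q (\sum_(i < n) (K i).+1) s0.
Proof.
move=> wfc rs0 inv0 step post.
suff main d i s : n = i + d -> ready s -> frame (modR c) (modA c) s0 s ->
    Inv i s -> wp (While e c) Q (\sum_(i <= j < n) (K j).+1) s.
  by rewrite -(big_mkord xpredT (fun i => (K i).+1)); apply: (main n).
elim: d i s => [|d IHd] i s eqn rs fr inv.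
  have [|tst _] := step i s _ rs fr inv; first by lia.
  have eni : n = i by rewrite eqn addn0.
  exists s, 0; split=> //; last by apply: post; rewrite // eni.
  by apply: RunWhileDone; rewrite -[_ == 0]negbK tst; lia.
have ltin : i < n by lia.
have [|tst body] := step i s _ rs fr inv; first by lia.
have [s1 [k1 [r1 le1 [rs1 fr1 inv1]]]] := wp_frame wfc rs (body ltin).
have [||s2 [k2 [r2 le2 Qs]]] := IHd i.+1 s1 _ rs1 _ inv1; first by lia.
  exact: frame_trans fr fr1.
exists s2, (k1 + k2).+1; split=> //.
  by apply: RunWhileStep r1 r2; rewrite tst.
by rewrite (big_cat_nat (n := i.+1)) //= big_nat1; lia.
Qed.

Lemma wp_while_const n (Inv : nat -> state -> Prop) (K : nat) e c Q s0 :
  wf c -> ready s0 -> Inv 0 s0 ->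
  (forall i s, i <= n -> ready s -> frame (modR c) (modA c) s0 s -> Inv i s ->
     (eval s e != 0) = (i < n) /\ (i < n -> wp c (Inv i.+1) K s)) ->
  (forall s, ready s -> frame (modR c) (modA c) s0 s -> Inv n s -> Q s) ->
  wp (While e c) Q (n * K.+1) s0.
Proof.
move=> wfc rs0 inv0 step post.
apply: wp_leq (wp_while (K := fun=> K) wfc rs0 inv0 step post) _.
by rewrite sum_nat_const card_ord.
Qed.

End Logic.

Arguments wp_write {B} base {k e e' i v Q K s}.
Arguments wp_frame {B} base {c Q K s}.
Arguments wp_while {B} base n Inv K {e c Q s0}.
Arguments wp_while_const {B} base n Inv {K e c Q s0}.
Arguments contents : simpl never.
Arguments setr : simpl never.
Arguments seta : simpl never.
Arguments eval : simpl never.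
Arguments eval_cell base {s k e}.

(** * Combinations in colexicographic order *)

Definition increasing (k : nat) (t : nat -> nat) : Prop :=
  forall i, i.+1 < k -> t i < t i.+1.

Definition combination (m k : nat) (t : nat -> nat) : Prop :=
  increasing k t /\ forall i, i < k -> t i < m.

(** The combinatorial number system: for increasing [t], the rank from 0 of the set of its first [k]
    values among all [k]-subsets of the naturals in colexicographic order. It does not depend on a
    ground set. *)
Definition colex (k : nat) (t : nat -> nat) : nat := \sum_(i < k) 'C(t i, i.+1).

Lemma colexS k t : colex k.+1 t = colex k t + 'C(t k, k.+1).
Proof. by rewrite /colex big_ord_recr. Qed.

Lemma increasing_leq k t i j : increasing k t -> i <= j < k -> t i + (j - i) <= t j.
Proof.
move=> inc /andP[+ ltjk]; elim: j ltjk => [|j IHj] ltjk leij.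
  by move: leij; rewrite leqn0 => /eqP->; rewrite addn0.
have [->|ltij] := eqVneq i j.+1; first by rewrite subnn addn0.
have := IHj (ltnW ltjk) _; have := inc j ltjk; lia.
Qed.

Lemma increasing_ltn k t i j : increasing k t -> i < j < k -> t i < t j.
Proof.
move=> inc /andP[ltij ltjk]; have := @increasing_leq k t i j inc; lia.
Qed.

Lemma increasingW k t : increasing k.+1 t -> increasing k t.
Proof. by move=> inc i lti; apply: inc; lia. Qed.

Lemma combinationP m k t : 0 < k ->
  combination m k t <-> increasing k t /\ t k.-1 < m.
Proof.
move=> k_gt0; split=> -[inc lt]; split=> //; first by apply: lt; lia.
move=> i ltik; have := @increasing_leq k t i k.-1 inc; lia.
Qed.

(** The elements below the top one have rank less than ['C(t k, k)]; adding the last term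
    ['C(t k, k.+1)] gives ['C((t k).+1, k.+1)] by Pascal's rule. *)
Lemma colex_ltn m k t : combination m k t -> colex k t < 'C(m, k).
Proof.
elim: k m => [|k IHk] m [inc lt]; first by rewrite /colex big_ord0 bin0.
have IH : colex k t < 'C(t k, k).
  apply: IHk; split=> [|i ltik]; first exact: increasingW.
  by apply: (increasing_ltn inc); rewrite ltik ltnSn.
rewrite colexS; apply: (@leq_trans 'C((t k).+1, k.+1)).
  by rewrite binS; lia.
by apply: leq_bin2l; apply: lt.
Qed.

(** The top element decides the order, by the bound just proved. Equal ranks thus have equal top
    elements, and induction removes these. *)
Lemma colex_inj k t u : increasing k t -> increasing k u ->
  colex k t = colex k u -> forall i, i < k -> t i = u i.
Proof.
have key k' t' u' : increasing k'.+1 t' -> t' k' < u' k' ->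
    colex k'.+1 t' < colex k'.+1 u'.
  move=> inc lt; apply: (@leq_trans 'C(u' k', k'.+1)).
    by apply: colex_ltn; apply/combinationP.
  by rewrite colexS leq_addl.
elim: k => // k IHk inct incu eqtu.
have eqk : t k = u k.
  have [lt|lt|//] := ltngtP (t k) (u k).
    by have := key k t u inct lt; rewrite eqtu ltnn.
  by have := key k u t incu lt; rewrite eqtu ltnn.
move=> i; rewrite ltnS leq_eqVlt => /predU1P[-> //|].
apply: IHk; [exact: increasingW | exact: increasingW |].
by move: eqtu; rewrite !colexS eqk; lia.
Qed.

(* The successor in colexicographic order increments the last element of the
   maximal initial run of consecutive numbers and resets those before it. *)
Definition next (i : nat) (t : nat -> nat) : nat -> nat :=
  fun j => if j < i then j else if j == i then (t i).+1 else t j.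

(** The reset elements contribute ['C(j, j.+1) = 0]. By the hockey-stick identity the old run
    [t 0, t 0 + 1, ..., t 0 + i] contributes exactly one less than its incremented last element. *)
Lemma colex_next k t i : i < k ->
  (forall j, j < i -> t j.+1 = (t j).+1) -> colex k (next i t) = (colex k t).+1.
Proof.
move=> ltik run; have tE j : j <= i -> t j = t 0 + j.
  by elim: j => [|j IHj] lej; rewrite ?addn0 // run // IHj ?addnS // ltnW.
have base : colex i.+1 (next i t) = (colex i.+1 t).+1.
  rewrite colexS {2}/next ltnn eqxx.
  have -> : colex i (next i t) = 0.
    rewrite /colex big1 // => j _; rewrite /next ltn_ord bin_small //.
  have -> : colex i.+1 t = colex i.+1 (addn (t 0)).
    by apply: eq_bigr => j _; rewrite tE // -ltnS.
  rewrite (tE i) // add0n; elim: {ltik run tE} i => [|i IHi].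
    by rewrite colexS /colex big_ord0 !bin1; lia.
  by rewrite colexS !addnS binS IHi addnC addSn.
elim: k ltik => // k IHk; rewrite ltnS leq_eqVlt => /predU1P[<- //|ltik].
rewrite !colexS IHk // /next.
by rewrite ltnNge (ltnW ltik) (gtn_eqF ltik).
Qed.

Lemma next_increasing k t i : i < k -> increasing k t ->
  (i.+1 < k -> (t i).+1 < t i.+1) -> increasing k (next i t).
Proof.
move=> ltik inc gap j ltj; have := inc j ltj.
have := @increasing_leq k t 0 i inc; rewrite /next.
case: (ltngtP j i) => [lt1|lt1|eq1]; last rewrite {}eq1 in ltj *;
  case: (ltngtP _.+1 i) => [lt2|lt2|eq2];
  rewrite ?eq2 //; lia.
Qed.

Definition skip (t : nat -> nat) (j : nat) : nat -> nat := fun i => t (bump j i).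

Lemma combination_skip m k t j : combination m k.+1 t -> combination m k (skip t j).
Proof.
move=> [inc lt]; split=> i lti; last by apply: lt; rewrite /bump; case: (j <= i); lia.
by apply: (increasing_ltn inc); rewrite /bump; lia.
Qed.

(** Omitting [t j] or [t j.+1] gives lists that differ only at position [j]. Two table lookups hence
    turn one rank into the next. *)
Lemma colex_skipS k t j : j < k ->
  colex k (skip t j.+1) + 'C(t j.+1, j.+1) = colex k (skip t j) + 'C(t j, j.+1).
Proof.
move=> ltj; rewrite /colex !(bigD1 (Ordinal ltj) (P := xpredT)) //= /skip.
have -> : bump j.+1 j = j by rewrite /bump; lia.
have -> : bump j j = j.+1 by rewrite /bump; lia.
rewrite addnAC [RHS]addnAC [X in X + _]addnC; congr (_ + _).
apply: eq_bigr => i ni; congr 'C(t _, _).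
by move: ni; rewrite -val_eqE /= /bump; lia.
Qed.

(** The [k - i] elements after [t i] must still fit below [m]. This keeps the lookups of ranks
    inside the band that [pascal] fills. *)
Lemma combination_leq m k t i : combination m k.+1 t -> i <= k -> t i < i + (m - k).
Proof.
move=> [inc lt] lei; have := @increasing_leq k.+1 t i k inc.
by have := lt k (ltnSn k); lia.
Qed.

(** * Enumerating combinations by a program *)

Lemma eval_const s k : eval s #k = k. Proof. by []. Qed.
Lemma eval_reg s x : eval s $x = reg s x. Proof. by []. Qed.
Lemma eval_add s a b : eval s (a |+| b) = eval s a + eval s b. Proof. by []. Qed.
Lemma eval_sub s a b : eval s (a |-| b) = eval s a - eval s b. Proof. by []. Qed.
Lemma eval_mul s a b : eval s (a |*| b) = eval s a * eval s b. Proof. by []. Qed.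
Lemma eval_read s a : eval s (Read a) = ram s (eval s a). Proof. by []. Qed.
Definition evalE :=
  (eval_const, eval_reg, eval_add, eval_sub, eval_mul,
   reg_setr, reg_seta, arr_setr, ram_setr, arr_seta).

Local Notation rIdx := 2 (only parsing).
Local Notation rSize := 3 (only parsing).
Local Notation rTop := 4 (only parsing).
Local Notation rI := 5 (only parsing).

(** The truncated difference in the guard is nonzero exactly when the next element is at most one
    larger, that is, while the run of consecutive numbers goes on. *)
Definition comb_next : cmd :=
  Assign rI #0;;
  While ((cell Comb $rI |+| #2) |-| cell Comb ($rI |+| #1))
    (Write (addr Comb $rI) $rI;; Assign rI ($rI |+| #1));;
  Write (addr Comb $rI) (cell Comb $rI |+| #1).

(** The cell after the combination receives the sentinel [m.+1]. Elements being below [m], it never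
    continues a run, so [comb_next] stops at the last element at the latest. *)
Definition comb_start : cmd :=
  Assign rI #0;;
  While ($rSize |-| $rI)
    (Write (addr Comb $rI) $rI;; Assign rI ($rI |+| #1));;
  Write (addr Comb $rSize) ($rTop |+| #1);;
  Assign rIdx #0.

Definition combinations (body : cmd) : cmd :=
  comb_start;;
  While ($rTop |-| cell Comb ($rSize |-| #1))
    (body;; Assign rIdx ($rIdx |+| #1);; comb_next).

Section Combinations.

Variables B base : nat.
Local Notation arr := (contents base).
Local Notation frame := (framed base).
Local Notation ready := (safe B base).
Local Notation wp := (runs B).

Lemma wp_comb_start k m s : ready s -> k < B -> m.+1 < B ->
  reg s rSize = k -> reg s rTop = m ->
  wp comb_start (fun s' => [/\ reg s' rIdx = 0, arr s' Comb k = m.+1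
                             & forall i, i < k -> arr s' Comb i = i])
     k s.
Proof.
move=> rs ltk ltm ek em; have [bs eb] := rs.
apply: wp_seq0; apply: (wp_assign (v := 0)); [by [] | by lia |].
apply: (@wp_seq _ k 0); first by rewrite addn0.
rewrite -[X in runs _ _ _ X](muln1 k).
apply: (wp_while_const base k
  (fun i s' => reg s' rI = i /\ forall j, j < i -> arr s' Comb j = j)).
- by [].
- by apply: ready_setr => //; lia.
- by [].
- move=> i s' lei rs' fr [ei inv]; have [_ eb'] := rs'; split.
    by case: fr => fr _ _; rewrite !evalE (fr rSize) // !evalE /= ei ek; lia.
  move=> lti; apply: wp_seq0.
  apply: (wp_write base (i := i) (v := i)) => //; first by lia.
  apply: (wp_assign (v := i.+1)); [by rewrite !evalE ei addn1 | by lia |].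
  split=> // j; rewrite !evalE /=.
  by case: eqP => // nji ltj; apply: inv; lia.
- move=> s' rs' [fr _ _] [ei inv]; have [_ eb'] := rs'.
  apply: wp_seq0; apply: (wp_write base (i := k) (v := m.+1)) => //.
  + by rewrite !evalE fr // !evalE.
  + by rewrite !evalE fr // !evalE /= em addn1.
  apply: (wp_assign (v := 0)); [by [] | by lia |].
  split=> //; rewrite ?evalE /= ?eqxx // => i lti.
  by rewrite !evalE /= (ltn_eqF lti) inv.
Qed.

Lemma wp_comb_next k m s : ready s -> m.+1 < B ->
  combination m k (arr s Comb) -> 0 < k -> k <= m -> arr s Comb k = m.+1 ->
  wp comb_next (fun s' =>
     [/\ increasing k (arr s' Comb), arr s' Comb k.-1 <= m,
         arr s' Comb k = m.+1
       & colex k (arr s' Comb) = (colex k (arr s Comb)).+1])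
     k s.
Proof.
move=> rs ltm [inc lt] k_gt0 lekm sent; have [bs eb] := rs.
set t := arr s Comb in inc lt sent *.
have stop : exists i, (i < k) && ((t i).+1 < t i.+1).
  by exists k.-1; rewrite prednK // leqnn sent; have := lt k.-1; lia.
case: (ex_minnP stop) => i0 /andP[lt0 gap] min.
have run j : j < i0 -> t j.+1 = (t j).+1.
  move=> ltj; have ltjk : j.+1 < k by lia.
  have := inc j ltjk; have := min j; lia.
apply: wp_seq0; apply: (wp_assign (v := 0)); [by [] | by lia |].
apply: (@wp_seq _ i0 0); first by rewrite addn0 ltnW.
rewrite -[X in runs _ _ _ X](muln1 i0).
apply: (wp_while_const base i0 (fun i s' => reg s' rI = i /\
    forall j, arr s' Comb j = if j < i then j else t j)).
- by [].
- by apply: ready_setr => //; lia.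
- by [].
- move=> i s' lei rs' fr [ei inv]; have [_ eb'] := rs'; split.
    rewrite !evalE !(eval_cell base) // !evalE ei addn1 !inv ltnn ltnNge leqnSn /=.
    move: lei; rewrite leq_eqVlt => /predU1P[->|lti].
      by rewrite ltnn; lia.
    by rewrite run // lti; lia.
  move=> lti; apply: wp_seq0.
  apply: (wp_write base (i := i) (v := i)) => //; first by lia.
  apply: (wp_assign (v := i.+1)); [by rewrite !evalE ei addn1 | by lia |].
  split=> // j; rewrite !evalE /= inv ltnS.
  by case: (ltngtP j i).
- move=> s' rs' _ [ei inv]; have [_ eb'] := rs'.
  apply: (wp_write base (i := i0) (v := (t i0).+1)) => //.
  + by rewrite evalE (eval_cell base) // !evalE ei inv ltnn addn1.
  + by have := lt i0 lt0; lia.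
  have E j : arr (seta base s' Comb i0 (t i0).+1) Comb j = next i0 t j.
    rewrite evalE /= inv /next; case: (eqVneq j i0) => [->|//].
    by rewrite ltnn.
  split.
  + move=> j ltj; rewrite !E; apply: (next_increasing lt0 inc _ ltj).
    by move=> _.
  + rewrite E /next; case: ifP => [|_]; first by lia.
    by have := lt k.-1; case: eqP => [<-|]; lia.
  + by rewrite E /next ltnNge (ltnW lt0) (gtn_eqF lt0).
  + rewrite -(colex_next lt0 run); apply: eq_bigr => j _; by rewrite E.
Qed.

(** Between two calls of [body] the enumeration itself changes [rIdx], [rI] and [Comb], so the
    invariant has to be stable under such changes. At each call the counter [rIdx] is the rank of
    the current combination, which is what numbers the rows. *)
Lemma wp_combinations body k m (Inv : nat -> state -> Prop) K Q s :
  [&& wf body, all (fun x => x \notin modR body) [:: rIdx; rSize; rTop]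
    & acode Comb \notin modA body] ->
  ready s -> reg s rSize = k -> reg s rTop = m ->
  0 < k -> k <= m -> m.+1 < B -> 'C(m, k) < B ->
  (forall i s1 s2, frame [:: rIdx; rI] [:: acode Comb] s1 s2 ->
     Inv i s1 -> Inv i s2) ->
  Inv 0 s ->
  (forall i s1, i < 'C(m, k) -> ready s1 ->
     frame (modR (combinations body)) (modA (combinations body)) s s1 ->
     reg s1 rIdx = i -> combination m k (arr s1 Comb) ->
     colex k (arr s1 Comb) = i -> Inv i s1 -> wp body (Inv i.+1) K s1) ->
  (forall s1, ready s1 ->
     frame (modR (combinations body)) (modA (combinations body)) s s1 ->
     reg s1 rIdx = 'C(m, k) -> Inv 'C(m, k) s1 -> Q s1) ->
  wp (combinations body) Q (k + 'C(m, k) * (K + k).+1) s.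
Proof.
case/and3P=> wfb /and4P[nI nS nT _] nC rs ek em k_gt0 lekm ltm ltC stab inv0 step post.
apply: (@wp_seq _ k ('C(m, k) * (K + k).+1)) => //.
have ltk : k < B by lia.
have start := wp_frame base (erefl : wf comb_start) rs (wp_comb_start rs ltk ltm ek em).
apply: wp_conseq start _ => s0 [rs0 fr0 [e0 sent0 c0]].
have sub1 (c : cmd) s1 s2 : frame [:: rIdx; rI] [:: acode Comb] s1 s2 ->
    frame (modR (combinations c)) (modA (combinations c)) s1 s2.
  exact: frame_all.
have sub2 s1 s2 :
    frame (modR (body;; Assign rIdx ($rIdx |+| #1);; comb_next))
      (modA (body;; Assign rIdx ($rIdx |+| #1);; comb_next)) s1 s2 ->
    frame (modR (combinations body)) (modA (combinations body)) s1 s2.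
  apply: frame_sub => x xin.
    exact: (mem_subseq (suffix_subseq (modR comb_start) _) xin).
  exact: (mem_subseq (suffix_subseq (modA comb_start) _) xin).
have fr0' : frame [:: rIdx; rI] [:: acode Comb] s s0.
  exact: frame_all fr0.
pose J i s1 := [/\ reg s1 rIdx = i, increasing k (arr s1 Comb),
  arr s1 Comb k.-1 <= m, arr s1 Comb k = m.+1 & colex k (arr s1 Comb) = i /\ Inv i s1].
apply: (wp_while_const base _ J).
- by rewrite /= wfb.
- by [].
- split=> //.
  + by move=> i lti; rewrite !c0 // ltnW.
  + by rewrite c0; lia.
  + split; last exact: stab inv0.
    by rewrite /colex big1 // => i _; rewrite c0 // bin_small.
- move=> i s1 lei rs1 fr1 [eI inc le sent [ec inv]]; have [_ eb1] := rs1.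
  have [[r0 _ _] [r1 _ _]] := (fr0', fr1).
  have eS : reg s1 rSize = k.
    by rewrite r1 ?r0 // mem_cat negb_or nS.
  have eT : reg s1 rTop = m.
    by rewrite r1 ?r0 // mem_cat negb_or nT.
  (* The guard looks at the last element, the loop rule at the counter. They agree: once the last
     element reaches [m], its term alone makes the rank at least ['C(m, k)]. *)
  have test : (arr s1 Comb k.-1 < m) = (i < 'C(m, k)).
    apply/idP/idP => [lt|]; first by rewrite -ec; apply/colex_ltn/combinationP.
    rewrite -ec; apply: contraTT; rewrite -!leqNgt => gem.
    move: k_gt0 gem; case: (k) => // k' _ /= gem.
    by apply: leq_trans (leq_bin2l _ gem) _; rewrite colexS leq_addl.
  split; first by rewrite !evalE (eval_cell base) // !evalE eS eT subn1 -test -lt0n subn_gt0.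
  move=> lti; have lt : arr s1 Comb k.-1 < m by rewrite test.
  have cmb : combination m k (arr s1 Comb) by apply/combinationP.
  have fr01 : frame (modR (combinations body)) (modA (combinations body)) s s1.
    apply: frame_trans (sub1 _ _ _ fr0') _.
    exact: sub2 fr1.
  apply: (@wp_seq _ K k) => //.
  apply: wp_conseq (wp_frame base wfb rs1 (step i s1 lti rs1 fr01 eI cmb ec inv)) _.
  move=> s2 [rs2 [fr2 _ fa2] inv2]; have [bs2 eb2] := rs2.
  apply: wp_seq0; apply: (wp_assign (v := i.+1)).
  + by rewrite !evalE fr2 // eI addn1.
  + by lia.
  set s3 := setr s2 rIdx i.+1.
  have E3 : arr s3 Comb =1 arr s1 Comb by move=> j; rewrite -fa2.
  have rs3 : ready s3 by apply: ready_setr => //; lia.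
  have cmb3 : combination m k (arr s3 Comb).
    by case: cmb => inc1 lt1; split=> [j|j] ltj; rewrite !E3; auto.
  have sent3 : arr s3 Comb k = m.+1 by rewrite E3.
  have nx := wp_frame base (erefl : wf comb_next) rs3 (wp_comb_next rs3 ltm cmb3 k_gt0 lekm sent3).
  apply: wp_conseq nx _.
  move=> s4 [rs4 fr4 [inc4 le4 sent4 ec4]]; split=> //.
    by case: fr4 => ->.
  split.
    by rewrite ec4 -ec; congr _.+1; apply: eq_bigr => j _; rewrite E3.
  apply: stab inv2; apply: (@frame_trans _ _ _ _ s3).
    split=> // x; rewrite !inE reg_setr => /norP[/negPf-> _] //.
  exact: frame_all fr4.
- move=> s1 rs1 fr1 [eI _ _ _ [_ inv]]; apply: post => //.
  apply: frame_trans (sub1 _ _ _ fr0') _.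
  exact: sub2 fr1.
Qed.

End Combinations.

(** * Families of edges *)

Local Notation rPos := 6 (only parsing).
Local Notation rE := 7 (only parsing).
Local Notation rV := 8 (only parsing).
Local Notation rSum := 9 (only parsing).
Local Notation rTarget := 10 (only parsing).
Local Notation rEdge := 12 (only parsing).
Local Notation rCount := 13 (only parsing).
Local Notation rFlag := 14 (only parsing).
Local Notation rRows := 15 (only parsing).
Local Notation rJ := 16 (only parsing).
Local Notation rP := 20 (only parsing).
Local Notation rVert := 21 (only parsing).
Local Notation rEdges := 22 (only parsing).

(** Membership of an edge is a threshold test: the weights [Mult] of its vertices must add up to at
    least [rTarget]. Weights counting occurrences in [p] listed [q]-subsets with target [p * q]
    select the edges containing all of them; unit weights with target [q] select the edges of size
    at least [q]. *)
Definition collect : cmd :=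
  let endpoint := $rIdx |*| $rVert |+| Read ($rPos |+| $rV |+| #1) in
  Assign rPos #3;;
  Assign rE #0;;
  While ($rEdges |-| $rE)
    (Assign rSum #0;;
     Assign rV #0;;
     While (Read $rPos |-| $rV)
       (Assign rSum ($rSum |+| cell Mult endpoint);;
        Assign rV ($rV |+| #1));;
     If ($rTarget |-| $rSum) Skip
       (Write (addr Ptr $rIdx) $rPos;;
        Write (addr Tot $rIdx) (cell Tot $rIdx |+| #1);;
        Assign rV #0;;
        While (Read $rPos |-| $rV)
          (Write (addr Cnt endpoint) (cell Cnt endpoint |+| #1);;
           Assign rV ($rV |+| #1)));;
     Assign rPos ($rPos |+| Read $rPos |+| #1);;
     Assign rE ($rE |+| #1)).

(** No edge is stored at address 0, so [rEdge = 0] encodes an empty union, for which nothing is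
    tested. A vertex is missed by some edge of a row exactly when [Tot] exceeds its [Cnt]. *)
Definition check (q : nat) : cmd :=
  let row := cell Row $rJ in
  let endpoint := row |*| $rVert |+| Read ($rEdge |+| $rV |+| #1) in
  If $rEdge
    (Assign rCount #0;;
     Assign rV #0;;
     While (Read $rEdge |-| $rV)
       (Assign rFlag #1;;
        Assign rJ #0;;
        While ($rRows |-| $rJ)
          (If (cell Tot row |-| cell Cnt endpoint) (Assign rFlag #0) Skip;;
           Assign rJ ($rJ |+| #1));;
        Assign rCount ($rCount |+| $rFlag);;
        Assign rV ($rV |+| #1));;
     If (#q |-| $rCount) (Assign rAns #0) Skip)
    Skip.

Lemma sum_subset (n : nat) (e : seq nat) (mu : nat -> nat) :
  uniq e -> (forall v, v \in e -> v < n) ->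
  \sum_(v <- e) mu v = \sum_(v < n | nat_of_ord v \in e) mu v.
Proof.
move=> ue lte; transitivity (\sum_(0 <= v < n | v \in e) mu v); last by rewrite big_mkord.
rewrite -[RHS]big_filter; apply: perm_big.
apply: uniq_perm => // [|v]; first by rewrite filter_uniq // iota_uniq.
rewrite mem_filter mem_index_iota /=; case: (boolP (v \in e)) => //= /lte.
by move=> ->.
Qed.

Lemma leq_sum_subset (n : nat) (e : seq nat) (mu : nat -> nat) :
  uniq e -> (forall v, v \in e -> v < n) ->
  \sum_(v <- e) mu v <= \sum_(v < n) mu v.
Proof.
by move=> ue lte; rewrite (sum_subset _ ue lte) big_mkcond leq_sum // => v _; case: ifP.
Qed.

Section Incidence.

Variables B base p n : nat.
Variable es : seq (seq nat).

Local Notation arr := (contents base).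
Local Notation frame := (framed base).
Local Notation ready := (safe B base).
Local Notation wp := (runs B).
Local Notation m := (size es).
Local Notation edge_at := (nth [::] es).

Definition input : seq nat :=
  [:: p, n, m & flatten [seq size e :: e | e <- es]].

(** Address of the size field of edge [i]; the 3 cells before the first edge are the header of the
    input. *)
Definition offset (i : nat) : nat := 3 + \sum_(j < i) (size (edge_at j)).+1.

Lemma offsetS i : offset i.+1 = offset i + (size (edge_at i)).+1.
Proof. by rewrite /offset big_ord_recr addnA. Qed.

Lemma leq_offset i j : i <= j -> offset i <= offset j.
Proof.
move=> leij; rewrite -(subnK leij); elim: (j - i) => // d IHd.
by rewrite addSn offsetS; lia.
Qed.

Lemma nth_input i k : i < m -> k <= size (edge_at i) ->
  nth 0 input (offset i + k) = nth 0 (size (edge_at i) :: edge_at i) k.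
Proof.
rewrite /offset -addnA /=; elim: es i => // e es' IH [|i] ltim lek /=.
  rewrite big_ord0 add0n -cat_cons nth_cat /= ltnS.
  by rewrite lek.
rewrite add0n big_ord_recl -addnA -cat_cons nth_cat [size (_ :: _)]/=.
by rewrite ltnNge leq_addr addKn -IH.
Qed.

Definition loaded (s : state) : Prop :=
  [/\ reg s rP = p, reg s rVert = n, reg s rEdges = m
    & forall a, a < base -> ram s a = nth 0 input a].

Lemma loaded_frame rs ks s s' :
  all (fun x => x \notin rs) [:: rP; rVert; rEdges] ->
  frame rs ks s s' -> loaded s -> loaded s'.
Proof.
case/and4P=> nP nV nE _ [fr fm _] [eP eV eE eM].
by split=> [|||a lt]; rewrite ?fr ?fm ?eM.
Qed.

Lemma loaded_setr s x v :
  x \notin [:: rP; rVert; rEdges] -> loaded s -> loaded (setr s x v).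
Proof.
rewrite !inE !negb_or => /and3P[n1 n2 n3] [eP eV eE eM].
by split=> //; rewrite reg_setr eq_sym ?(negPf n1) ?(negPf n2) ?(negPf n3).
Qed.

Lemma loaded_seta s k i v : loaded s -> loaded (seta base s k i v).
Proof. by move=> [eP eV eE eM]; split=> // a lt; rewrite ram_seta ?eM. Qed.

Hypothesis es_uniq : forall i, uniq (edge_at i).
Hypothesis es_lt : forall i v, v \in edge_at i -> v < n.
Hypothesis offset_base : offset m <= base.

Lemma size_edge i : size (edge_at i) <= n.
Proof.
rewrite -[n](size_iota 0); apply: uniq_leq_size => // v /es_lt.
by rewrite mem_iota.
Qed.

Lemma offset_lt i : i < m -> offset i + size (edge_at i) < base.
Proof. by move=> /leq_offset; rewrite offsetS; lia. Qed.

Lemma loaded_size s i : loaded s -> i < m -> ram s (offset i) = size (edge_at i).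
Proof.
move=> [_ _ _ eM] ltim; have := offset_lt ltim => lt; rewrite eM; last by lia.
by rewrite -[offset i]addn0 nth_input.
Qed.

Lemma loaded_nth s i k : loaded s -> i < m -> k < size (edge_at i) ->
  ram s (offset i + k + 1) = nth 0 (edge_at i) k.
Proof.
move=> [_ _ _ eM] ltim ltk; have := offset_lt ltim => lt; rewrite eM; last by lia.
by rewrite -addnA addn1 nth_input.
Qed.

Lemma size_leq_offset i : i <= offset i.
Proof. by elim: i => // i IHi; rewrite offsetS; lia. Qed.

Hypothesis base_B : base < B.

Lemma m_lt : m < B.
Proof. by have := size_leq_offset m; lia. Qed.

Definition row_of (s : state) (r : nat) (F : pred nat) : Prop :=
  [/\ arr s Tot r = \sum_(i < m) F i,
      forall v, v < n -> arr s Cnt (r * n + v) = \sum_(i < m) (F i && (v \in edge_at i))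
    & (arr s Ptr r = 0 /\ forall i, i < m -> ~~ F i)
      \/ exists i, [/\ i < m, F i & arr s Ptr r = offset i]].

Lemma row_of_eq s r (F F' : pred nat) : (forall i, i < m -> F i = F' i) ->
  row_of s r F -> row_of s r F'.
Proof.
move=> eqF [eT eC eP]; split=> [|v ltv|].
- by rewrite eT; apply: eq_bigr => i _; rewrite eqF.
- by rewrite eC //; apply: eq_bigr => i _; rewrite eqF.
- case: eP => [[e0 nF]|[i [lti Fi ei]]]; [left|right].
    by split=> // i lti; rewrite -eqF // nF.
  by exists i; rewrite -eqF.
Qed.

Definition row_clear (s : state) (r : nat) : Prop :=
  [/\ arr s Tot r = 0, arr s Ptr r = 0
    & forall v, v < n -> arr s Cnt (r * n + v) = 0].

Definition only_row (r : nat) (s s' : state) : Prop :=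
  [/\ forall j, j != r -> arr s' Tot j = arr s Tot j,
      forall j, j != r -> arr s' Ptr j = arr s Ptr j
    & forall j, ~~ (r * n <= j < r * n + n) -> arr s' Cnt j = arr s Cnt j].

Lemma row_of_frame rs ks s s' r F :
  all (fun k => acode k \notin ks) [:: Tot; Cnt; Ptr] ->
  frame rs ks s s' -> row_of s r F -> row_of s' r F.
Proof.
case/and4P=> nT nC nP _ [_ _ fa] [eT eC eP].
by split=> [|v ltv|]; rewrite fa //; exact: eC.
Qed.

(** Each edge is scanned at most twice, once to weigh it and once to raise the degrees of its
    vertices. Since its vertices are distinct, the total weight of all vertices bounds every partial
    sum that is stored. *)
Lemma wp_collect s0 r mu tg :
  ready s0 -> loaded s0 -> reg s0 rIdx = r -> reg s0 rTarget = tg ->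
  (forall v, v < n -> arr s0 Mult (r * n + v) = mu v) ->
  row_clear s0 r -> \sum_(v < n) mu v < B ->
  wp collect
    (fun s => row_of s r (fun i => tg <= \sum_(v <- edge_at i) mu v)
              /\ only_row r s0 s)
    (\sum_(i < m) (2 * size (edge_at i)).+1) s0.
Proof.
move=> rs0 ld0 er et emu [cT cP cC] ltmu; set F := fun i => tg <= _.
have ltm := m_lt; have ltoff : 3 < B by have := leq_offset (leq0n m); rewrite {1}/offset big_ord0; lia.
apply: wp_seq0; apply: (wp_assign (v := 3)) => //.
apply: wp_seq0; apply: (wp_assign (v := 0)) => //; first by lia.
pose Inv i s := [/\ reg s rPos = offset i, reg s rE = i,
  [/\ arr s Tot r = \sum_(i' < i) F i',
      forall v, v < n -> arr s Cnt (r * n + v) = \sum_(i' < i) (F i' && (v \in edge_at i'))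
    & (arr s Ptr r = 0 /\ forall i', i' < i -> ~~ F i')
      \/ exists i', [/\ i' < i, F i' & arr s Ptr r = offset i']]
  & only_row r s0 s].
apply: (wp_while base m Inv (fun i => 2 * size (edge_at i))) => //.
- by apply: ready_setr => //; [lia|apply: ready_setr].
- split=> //; first by rewrite /offset big_ord0.
  split; first by rewrite !evalE big_ord0 cT.
    by move=> v ltv; rewrite !evalE big_ord0; exact: cC.
  by left; rewrite !evalE cP.
- move=> i s lei rs fr [ePos eE [iT iC iP] only].
  have ld : loaded s by apply: (loaded_frame _ fr).
  have [_ eV eM _] := ld; split; first by rewrite !evalE eE eM; lia.
  move=> lti; have lto := offset_lt lti; have ltn' := size_edge i.
  have eI : reg s rIdx = r by case: fr => ->.
  have eTg : reg s rTarget = tg by case: fr => ->.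
  apply: wp_seq0; apply: (wp_assign (v := 0)) => //; first by lia.
  apply: wp_seq0; apply: (wp_assign (v := 0)) => //; first by lia.
  apply: (@wp_seq _ (size (edge_at i) * 1) (size (edge_at i))); first by lia.
  apply: (wp_while_const base _ (fun j s' => reg s' rV = j /\
    reg s' rSum = \sum_(v <- take j (edge_at i)) mu v)) => //.
  + by do 2!(apply: ready_setr => //; first by lia).
  + by rewrite take0 big_nil.
  + move=> j s1 lej rs1 fr1 [ej esum].
    have ld1 : loaded s1 by apply: (loaded_frame _ fr1).
    have [_ eV1 _ _] := ld1; have [_ eb1] := rs1.
    have ePos1 : reg s1 rPos = offset i by case: fr1 => ->.
    split; first by rewrite !evalE eval_read !evalE ePos1 (loaded_size ld1) // ej; lia.
    move=> ltj; set v := nth 0 (edge_at i) j.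
    have vin : v \in edge_at i by apply: mem_nth.
    have ltv := es_lt vin.
    have esum' : reg s1 rSum + mu v = \sum_(v <- take j.+1 (edge_at i)) mu v.
      by rewrite (take_nth 0) // -cats1 big_cat big_seq1 esum.
    have ltsum : \sum_(v <- take j.+1 (edge_at i)) mu v < B.
      apply: leq_ltn_trans ltmu; apply: leq_sum_subset; first exact: take_uniq.
      by move=> u /mem_take /es_lt.
    apply: wp_seq0; apply: (wp_assign (v := \sum_(v <- take j.+1 (edge_at i)) mu v)) => //.
      rewrite !evalE (eval_cell base) // !evalE eval_read !evalE ePos1 ej.
      rewrite (loaded_nth ld1) // eV1 -esum' -/v; congr (_ + _).
      have -> : reg s1 rIdx = r by case: fr1 => ->.
      case: fr1 => _ _ ->//; rewrite !evalE; case: fr => _ _ ->//.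
      by rewrite !evalE emu.
    apply: (wp_assign (v := j.+1)); [by rewrite !evalE ej addn1 | by lia |].
    by split.
  move=> s1 rs1 fr1 [_]; rewrite take_size => esum.
  have ld1 : loaded s1 by apply: (loaded_frame _ fr1).
  have [[fr1r _ fr1a] [_ eb1]] := (fr1, rs1).
  have ePos1 : reg s1 rPos = offset i by rewrite fr1r.
  have eE1 : reg s1 rE = i by rewrite fr1r.
  have eI1 : reg s1 rIdx = r by rewrite fr1r.
  have A1 k j : arr s1 k j = arr s k j by rewrite fr1a.
  apply: (@wp_seq _ (size (edge_at i)) 0); first by lia.
  pose Post s2 := [/\ reg s2 rPos = offset i, reg s2 rE = i, ready s2, loaded s2 &
    [/\ arr s2 Tot r = \sum_(i' < i.+1) F i',
      forall v, v < n -> arr s2 Cnt (r * n + v) = \sum_(i' < i.+1) (F i' && (v \in edge_at i')),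
      (arr s2 Ptr r = 0 /\ forall i', i' < i.+1 -> ~~ F i')
      \/ exists i', [/\ i' < i.+1, F i' & arr s2 Ptr r = offset i']
      & only_row r s0 s2]].
  apply: (@wp_conseq _ _ Post); last first.
    move=> s2 [ePos2 eE2 [_ eb2] ld2 [? ? ? ?]].
    apply: wp_seq0; apply: (wp_assign (v := offset i.+1)).
    - rewrite !evalE eval_read !evalE ePos2 (loaded_size ld2) // offsetS.
      by rewrite -addnA addn1.
    - by rewrite offsetS; lia.
    apply: (wp_assign (v := i.+1)); [by rewrite !evalE eE2 addn1 | by lia |].
    by split.
  apply: wp_if => [|hit].
    rewrite !evalE fr1r // !evalE /= eTg esum => miss; apply: wp_skip.
    have nF : F i = false by rewrite /F; lia.
    split=> //; split.
    - by rewrite A1 big_ord_recr /= nF addn0.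
    - by move=> v ltv; rewrite A1 big_ord_recr /= nF addn0 iC.
    - rewrite A1; case: iP => [[e0 no]|[i' [lti' Fi' ei']]]; [left|right].
        split=> // i'; rewrite ltnS leq_eqVlt => /predU1P[->|]; [by rewrite nF | exact: no].
      by exists i'; rewrite ltnW.
    - by case: only => oT oP oC; split=> j nj; rewrite A1; auto.
  have Fi : F i.
    by move: hit; rewrite !evalE fr1r // !evalE /= eTg esum /F; lia.
  apply: wp_seq0; apply: (wp_write base (i := r) (v := offset i)) => //; first by lia.
  have ltT : (\sum_(i' < i) F i').+1 < B.
    apply: leq_ltn_trans ltm; apply: leq_trans lti; rewrite ltnS.
    rewrite -[X in _ <= X]muln1 -[X in _ <= X * _](card_ord i) -sum_nat_const.
    by rewrite leq_sum // => x _; case: (F x).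
  apply: wp_seq0; apply: (wp_write base (i := r) (v := (\sum_(i' < i) F i').+1)) => //.
    by rewrite !evalE (eval_cell base) // !evalE /= eI1 A1 iT addn1.
  apply: wp_seq0; apply: (wp_assign (v := 0)) => //; first by lia.
  set s2 := setr _ _ _.
  have rs2 : ready s2.
    apply: ready_setr; [by [] | by lia |]; apply: ready_seta; first exact: ltT.
    by apply: ready_seta => //; lia.
  have ld2 : loaded s2 by apply: loaded_setr => //; do 2 apply: loaded_seta.
  have A2 k j : arr s2 k j = if asame k Tot && (j == r) then (\sum_(i' < i) F i').+1
       else if asame k Ptr && (j == r) then offset i else arr s k j.
    by rewrite !evalE A1.
  have [vR2 ePos2 eE2 eI2] : [/\ reg s2 rV = 0, reg s2 rPos = offset i,
    reg s2 rE = i & reg s2 rIdx = r] by rewrite !evalE.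
  clearbody s2.
  rewrite -[X in runs _ _ _ X]muln1.
  apply: (wp_while_const base _ (fun j s' => reg s' rV = j /\
     [/\ forall v, v < n -> arr s' Cnt (r * n + v) =
          \sum_(i' < i) (F i' && (v \in edge_at i')) + (v \in take j (edge_at i)),
        forall j, arr s' Tot j = arr s2 Tot j,
        forall j, arr s' Ptr j = arr s2 Ptr j
        & forall j, ~~ (r * n <= j < r * n + n) -> arr s' Cnt j = arr s Cnt j])) => //.
  + split=> //; split.
    * by move=> v ltv; rewrite A2 /= take0 addn0; apply: iC.
    * by [].
    * by [].
    * by move=> j _; rewrite A2.
  + move=> j s3 lej rs3 fr3 [ej [jC jT jP jo]].
    have fr23 : frame [:: rV] [:: acode Cnt] s2 s3 by apply: frame_all fr3.
    have ld3 : loaded s3.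
      exact: loaded_frame fr23 ld2.
    have [_ eV3 _ _] := ld3; have [_ eb3] := rs3.
    have ePos3 : reg s3 rPos = offset i by case: fr23 => ->.
    have eI3 : reg s3 rIdx = r by case: fr23 => ->.
    split; first by rewrite !evalE eval_read !evalE ePos3 (loaded_size ld3) // ej; lia.
    move=> ltj; set v := nth 0 (edge_at i) j.
    have vin : v \in edge_at i by apply: mem_nth.
    have ltv := es_lt vin.
    have evE : eval s3 ($rIdx |*| $rVert |+| Read ($rPos |+| $rV |+| #1)) = r * n + v.
      by rewrite !evalE eval_read !evalE ePos3 ej (loaded_nth ld3) // eV3 eI3.
    (* An edge lists each vertex once, so this degree has not been raised for the same edge
       before. *)
    have vnt : v \in take j (edge_at i) = false.
      have := take_uniq j.+1 (es_uniq i); rewrite (take_nth 0) // rcons_uniq.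
      by case/andP=> /negPf.
    apply: wp_seq0; apply: (wp_write base (i := r * n + v)
      (v := (arr s3 Cnt (r * n + v)).+1)) => //.
    * by rewrite !evalE (eval_cell base) // evE addn1.
    * rewrite jC // vnt addn0; apply: leq_ltn_trans ltT; rewrite ltnS.
      by apply: leq_sum => x _; case: (F x) => //; case: (_ \in _).
    apply: (wp_assign (v := j.+1)); [by rewrite !evalE ej addn1 | by lia |].
    split=> //; split.
    * move=> u ltu; rewrite !evalE /= eqn_add2l (take_nth 0) // mem_rcons inE -/v jC //.
      case: (eqVneq u v) => [->|_] /=; last by rewrite jC.
      by rewrite vnt addn0 addn1.
    * by move=> j'; rewrite !evalE /= jT.
    * by move=> j'; rewrite !evalE /= jP.
    * move=> j' nj'; rewrite !evalE /=; case: eqP => [ej'|_]; last exact: jo.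
      by case/negP: nj'; rewrite ej' leq_addr ltn_add2l.
  move=> s3 rs3 fr3 [ej [jC jT jP jo]].
  have fr23 : frame [:: rV] [:: acode Cnt] s2 s3 by apply: frame_all fr3.
  split=> //.
  + by case: fr23 => ->.
  + by case: fr23 => ->.
  + exact: loaded_frame fr23 ld2.
  split.
  + by rewrite jT A2 /= eqxx big_ord_recr /= Fi addn1.
  + by move=> v ltv; rewrite jC // take_size big_ord_recr /= Fi.
  + by right; exists i; rewrite ltnSn Fi jP A2 /= eqxx.
  + case: only => oT oP oC; split=> j nj.
    * by rewrite jT A2 /= (negPf nj) oT.
    * by rewrite jP A2 /= (negPf nj) oP.
    * by rewrite jo // oC.
- move=> s rs fr [_ _ [eT eC eP] only]; split=> //; split=> //.
Qed.

Definition common (J : nat) (F : nat -> pred nat) (v : nat) : bool :=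
  all (fun j => all (fun i => F j i ==> (v \in edge_at i)) (iota 0 m)) (iota 0 J).

(** The condition on the core of a bad set, phrased for the union of [J] families of numbered edges
    so that it matches what [check] computes; [small_coreE] relates it to [core]. *)
Definition small_core (q J : nat) (F : nat -> pred nat) : bool :=
  ~~ all (fun j => all (fun i => ~~ F j i) (iota 0 m)) (iota 0 J)
  && (count (common J F) (iota 0 n) < q).

(** The degree is termwise at most the size of the family, so equality of the two sums forces
    equality of all terms. *)
Lemma row_test s r F v : row_of s r F -> v < n ->
  (arr s Tot r - arr s Cnt (r * n + v) == 0)
  = all (fun i => F i ==> (v \in edge_at i)) (iota 0 m).
Proof.
move=> [-> eC _] ltv; rewrite eC // subn_eq0.
have leF i : (F i && (v \in edge_at i) : nat) <= F i by case: (F i); case: (_ \in _).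
have := leqif_sum (fun (i : 'I_m) (_ : true) =>
  leqif_eq (leF i)).
move=> leif; rewrite (geq_leqif leif).
apply/forallP/allP => [h i|h i].
  by rewrite mem_iota => /= lti; have := h (Ordinal lti) => /=;
    case: (F i); case: (_ \in _).
by have := h i; rewrite mem_iota ltn_ord /= => /(_ isT); case: (F i); case: (_ \in _).
Qed.

Lemma wp_check q s0 J I F R (a : bool) :
  ready s0 -> loaded s0 -> reg s0 rRows = J -> reg s0 rAns = a ->
  (forall j, j < J -> arr s0 Row j = I j /\ row_of s0 (I j) (F j)) ->
  J < B -> (forall i, i < m -> size (edge_at i) <= R) ->
  (reg s0 rEdge = 0 /\ (forall j i, j < J -> i < m -> ~~ F j i))
  \/ (exists j i, [/\ j < J, i < m, F j i & reg s0 rEdge = offset i]) ->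
  wp (check q) (fun s => reg s rAns = a && ~~ small_core q J F)
    (R * J.+1) s0.
Proof.
move=> rs0 ld0 eJ0 ea rows ltJ leR edge; have ltm := m_lt.
have offset_gt0 i : 0 < offset i by [].
have ltoff : 3 < B by have := leq_offset (leq0n m); rewrite {1}/offset big_ord0; lia.
apply: wp_if => [|e0]; last first.
  apply: wp_skip; rewrite ea /small_core; case: edge => [[_ no]|[j [i [_ _ _ ei]]]]; last first.
    by move: e0; rewrite !evalE ei; have := offset_gt0 i; lia.
  have -> : all (fun j => all (fun i => ~~ F j i) (iota 0 m)) (iota 0 J).
    apply/allP=> j; rewrite mem_iota => ltj; apply/allP=> i; rewrite mem_iota => lti.
    exact: no.
  by rewrite andbT.
rewrite evalE => enz; case: edge => [[e0 _]|[j0 [i [ltj0 lti Fi ei]]]].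
  by rewrite e0 in enz.
have {enz} ne : all (fun j => all (fun i => ~~ F j i) (iota 0 m)) (iota 0 J) = false.
  apply/negbTE/negP=> /allP/(_ j0); rewrite mem_iota ltj0 => /(_ isT)/allP/(_ i).
  by rewrite mem_iota lti Fi => /(_ isT).
set e := edge_at i in ei; have lte : size e <= R by apply: leR.
have lto : offset i + size e < base := offset_lt lti.
have leC j : count (common J F) (take j e) <= size e.
  by apply: leq_trans (count_size _ _) _; rewrite size_take; case: ltnP; lia.
(* Every common vertex lies on the selected edge, a member of family [j0], so counting along that
   edge loses none. *)
have countE : count (common J F) (iota 0 n) = count (common J F) e.
  rewrite -!size_filter; apply/perm_size/uniq_perm.
  - by rewrite filter_uniq ?iota_uniq.
  - by rewrite filter_uniq ?es_uniq.
  move=> v; rewrite !mem_filter mem_iota /=.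
  have [cv|//] := boolP (common J F v).
  have vin : v \in e.
    move/allP: cv => /(_ j0); rewrite mem_iota ltj0 => /(_ isT)/allP/(_ i).
    by rewrite mem_iota lti Fi => /(_ isT).
  by rewrite vin (es_lt vin).
apply: wp_seq0; apply: (wp_assign (v := 0)) => //; first by lia.
apply: wp_seq0; apply: (wp_assign (v := 0)) => //; first by lia.
apply: (@wp_seq _ (size e * (J * 1).+1) 0); first by rewrite muln1; nia.
apply: (wp_while_const base (size e) (fun j s => reg s rV = j /\
    reg s rCount = count (common J F) (take j e))).
- by [].
- by do 2!(apply: ready_setr => //; first by lia).
- by rewrite !evalE /= take0.
- move=> k s lek rs fr [ek ec].
  have [_ eb] := rs; have ld : loaded s by apply: loaded_frame fr _.
  have [_ eV _ _] := ld; have ee : reg s rEdge = offset i by case: fr => ->.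
  split; first by rewrite !evalE eval_read !evalE ee (loaded_size ld) // -/e ek; lia.
  move=> ltk; set v := nth 0 e k.
  have ltv : v < n by apply: (@es_lt i); apply: mem_nth.
  apply: wp_seq0; apply: (wp_assign (v := 1)) => //; first by lia.
  apply: wp_seq0; apply: (wp_assign (v := 0)) => //; first by lia.
  apply: (@wp_seq _ (J * 1) 0); first by lia.
  apply: (wp_while_const base J (fun j s => reg s rJ = j /\
     reg s rFlag = common j F v)).
  + by [].
  + by do 2!(apply: ready_setr => //; first by lia).
  + by [].
  + move=> j s1 lej rs1 fr1 [ej ef].
    have [_ eb1] := rs1; have ld1 : loaded s1 by apply: loaded_frame fr1 ld.
    have [_ eV1 _ _] := ld1; have [fr1r _ fr1a] := fr1; have [frr _ fra] := fr.
    have ee1 : reg s1 rEdge = offset i by rewrite fr1r.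
    have eJ1 : reg s1 rRows = J by rewrite fr1r // !evalE frr.
    split; first by rewrite !evalE eJ1 ej; lia.
    move=> ltj; have [rowj rj] := rows j ltj.
    have A1 k' j' : arr s1 k' j' = arr s0 k' j' by rewrite fr1a // !evalE fra.
    have evR : eval s1 (cell Row $rJ) = I j by rewrite (eval_cell base) // evalE ej A1 rowj.
    have evE : eval s1 (cell Tot (cell Row $rJ) |-| cell Cnt (cell Row $rJ |*| $rVert
        |+| Read ($rEdge |+| $rV |+| #1))) = arr s0 Tot (I j) - arr s0 Cnt (I j * n + v).
      rewrite eval_sub !(eval_cell base) // !evalE eval_read !evalE !evR ee1 eV1.
      have -> : reg s1 rV = k by rewrite fr1r.
      by rewrite (loaded_nth ld1) // !A1 ej rowj.
    have cS : common j.+1 F v = common j F v && (arr s0 Tot (I j) - arr s0 Cnt (I j * n + v) == 0).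
      by rewrite (row_test rj ltv) /common -[j.+1]addn1 iotaD all_cat /= andbT.
    apply: wp_seq0; apply: wp_if; rewrite evE => t.
    * apply: (wp_assign (v := 0)) => //; first by lia.
      apply: (wp_assign (v := j.+1)); [by rewrite !evalE ej addn1 | by lia |].
      by rewrite !evalE /= cS (negPf t) andbF.
    * apply: wp_skip.
      apply: (wp_assign (v := j.+1)); [by rewrite !evalE ej addn1 | by lia |].
      by rewrite !evalE /= cS t eqxx andbT.
  + move=> s1 rs1 [fr1r _ _] [_ ef].
    have cS : count (common J F) (take k e) + common J F v = count (common J F) (take k.+1 e).
      by rewrite (take_nth 0) // -cats1 count_cat /= addn0.
    apply: wp_seq0; apply: (wp_assign (v := count (common J F) (take k.+1 e))).
    * by rewrite !evalE ef fr1r // !evalE /= ec.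
    * by have := leC k.+1; lia.
    apply: (wp_assign (v := k.+1)); [by rewrite !evalE fr1r // !evalE /= ek addn1 | by lia |].
    by rewrite !evalE.
- move=> s rs [fr _ _] [_]; rewrite take_size => ec.
  apply: wp_if; rewrite !evalE ec => t.
  + apply: (wp_assign (v := 0)) => //; first by lia.
    by rewrite !evalE /= /small_core ne countE; case: (ltnP _ q) t => //; [rewrite andbF | lia].
  + apply: wp_skip; rewrite fr // !evalE /= ea /small_core ne countE.
    by case: (ltnP _ q) t => //; [lia | rewrite andbT].
Qed.

End Incidence.

(** * Families indexed by sets of q-subsets *)

Local Notation rX := 11 (only parsing).
Local Notation rN := 17 (only parsing).
Local Notation rB := 18 (only parsing).
Local Notation rC := 19 (only parsing).

(** The final value of the enumeration counter is the number of [q]-subsets; this is how [rN] is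
    computed. *)
Definition list_subsets (q : nat) : cmd :=
  Assign rSize #q;;
  Assign rTop $rVert;;
  combinations
    (Assign rV #0;;
     While (#q |-| $rV)
       (Write (addr Subset ($rIdx |*| #q |+| $rV)) (cell Comb $rV);;
        Assign rV ($rV |+| #1)));;
  Assign rN $rIdx.

Definition binom_at (b a : expr) : expr := cell Binom (b |*| $rN |+| a).

(** Row [b] is filled only for [b <= a < b + (N - p)]. All entries of this band are at most
    ['C(N, p)], whereas other entries with [a < N] can exceed it when [p] is large. Left of the band
    the initial 0 is already the right value. *)
Definition pascal : cmd :=
  Assign rC #0;;
  While ($rN |-| $rP |-| $rC)
    (Write (addr Binom $rC) #1;;
     Assign rC ($rC |+| #1));;
  Assign rB #0;;
  While ($rP |-| $rB)
    (Assign rC #0;;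
     While ($rN |-| $rP |-| $rC)
       (Write (addr Binom (($rB |+| #1) |*| $rN |+| ($rB |+| $rC |+| #1)))
          (binom_at ($rB |+| #1) ($rB |+| $rC) |+| binom_at $rB ($rB |+| $rC));;
        Assign rC ($rC |+| #1));;
     Assign rB ($rB |+| #1)).

Definition mark (q : nat) : cmd :=
  let place := $rIdx |*| $rVert
                 |+| cell Subset (cell Comb $rJ |*| #q |+| $rV) in
  Assign rJ #0;;
  While ($rP |-| $rJ)
    (Assign rV #0;;
     While (#q |-| $rV)
       (Write (addr Mult place) (cell Mult place |+| #1);;
        Assign rV ($rV |+| #1));;
     Assign rJ ($rJ |+| #1)).

Definition fill_rows (q : nat) : cmd :=
  Assign rSize $rP;;
  Assign rTop $rN;;
  Assign rTarget ($rP |*| #q);;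
  combinations (mark q;; collect).

Definition put_row : cmd :=
  Write (addr Row $rJ) $rX;;
  If (cell Ptr $rX) (Assign rEdge (cell Ptr $rX)) Skip.

(** The first loop computes the rank of the combination without its element 0; the second one moves
    the omitted position upwards. Adding before subtracting keeps the truncated difference exact.
    [rEdge] ends up at an edge of some nonempty row, if there is one. *)
Definition select_rows : cmd :=
  Assign rX #0;;
  Assign rJ #0;;
  While ($rP |-| $rJ)
    (Assign rX ($rX |+| binom_at ($rJ |+| #1) (cell Comb ($rJ |+| #1)));;
     Assign rJ ($rJ |+| #1));;
  Assign rEdge #0;;
  Assign rJ #0;;
  put_row;;
  While ($rP |-| $rJ)
    (Assign rX ($rX |+| binom_at ($rJ |+| #1) (cell Comb $rJ)
                  |-| binom_at ($rJ |+| #1) (cell Comb ($rJ |+| #1)));;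
     Assign rJ ($rJ |+| #1);;
     put_row).

Definition check_all (q : nat) : cmd :=
  Assign rSize ($rP |+| #1);;
  Assign rTop $rN;;
  Assign rRows ($rP |+| #1);;
  Assign rAns #1;;
  combinations (select_rows;; check q).

Lemma eqn_index N b a b' a' : a < N -> a' < N ->
  (b * N + a == b' * N + a') = (b == b') && (a == a').
Proof.
move=> lta lta'; apply/eqP/andP => [eq|[/eqP-> /eqP->]//].
have N_gt0 : 0 < N by lia.
have := congr1 (divn^~ N) eq; rewrite !divnMDl // !divn_small // !addn0 => eqb.
by split; apply/eqP => //; move: eq; rewrite eqb => /addnI.
Qed.

(** The number of lattice paths with [x] and [y] steps grows in both arguments; it bounds the
    entries of the band by its far corner ['C(N, p)]. *)
Lemma leq_bin_add x y x' y' : x <= x' -> y <= y' -> 'C(x + y, x) <= 'C(x' + y', x').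
Proof.
move=> lex ley; apply: (@leq_trans 'C(x + y', x)); first by rewrite leq_bin2l ?leq_add2l.
rewrite -bin_sub ?leq_addr // addKn -(@bin_sub (x' + y')) ?leq_addr // addKn.
by rewrite leq_bin2l // leq_add2r.
Qed.

(** * Correctness and cost of the phases of the general case *)

Section Phases.

Variables B base p n q : nat.
Variable es : seq (seq nat).

Local Notation arr := (contents base).
Local Notation frame := (framed base).
Local Notation ready := (safe B base).
Local Notation wp := (runs B).
Local Notation m := (size es).
Local Notation edge_at := (nth [::] es).
Local Notation N := 'C(n, q).
Local Notation loaded := (loaded base p n es).
Local Notation row_of := (row_of base n es).

Hypothesis base_B : base < B.
Hypothesis q_gt0 : 0 < q.
Hypothesis p_gt0 : 0 < p.
Hypothesis ltpN : p < N.
Hypothesis n_B : n.+1 < B.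
Hypothesis N_B : N.+1 < B.
Hypothesis CNp_B : 2 * 'C(N, p) < B.

Lemma leqn_q : q <= n.
Proof. by rewrite -bin_gt0; apply: leq_ltn_trans ltpN. Qed.

Lemma wp_list_subsets s0 : ready s0 -> loaded s0 ->
  wp (list_subsets q) (fun s => reg s rN = N /\
     forall i, i < N -> combination n q (fun k => arr s Subset (i * q + k))
                        /\ colex q (fun k => arr s Subset (i * q + k)) = i)
   (q + N * (q * 1 + q).+1) s0.
Proof.
move=> rs0 ld0; have [_ eV _ _] := ld0; have leqn := leqn_q.
apply: wp_seq0; apply: (wp_assign (v := q)) => //; first by lia.
apply: wp_seq0; apply: (wp_assign (v := n)) => //; first by lia.
apply: (@wp_seq _ (q + N * (q * 1 + q).+1) 0); first by rewrite addn0.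
set s1 := setr _ _ _.
apply: (@wp_combinations B base _ q n (fun i s => forall i', i' < i ->
    combination n q (fun k => arr s Subset (i' * q + k))
    /\ colex q (fun k => arr s Subset (i' * q + k)) = i')) => //.
- by do 2!(apply: ready_setr => //; first by lia).
- exact: ltnW.
- move=> i s s' [_ _ fa] h i' /h; have E k : arr s' Subset k = arr s Subset k by apply: fa.
  rewrite /combination /increasing /colex.
  move=> [[h1 h2] h3]; split; first by split=> k; rewrite !E; [apply: h1 | apply: h2].
  by rewrite -[RHS]h3; apply: eq_bigr => k _; rewrite E.
- move=> i s lti rs fr eI [cinc clt] cidx prev.
  apply: wp_seq0; apply: (wp_assign (v := 0)) => //; first by lia.
  apply: (wp_while_const base q (fun k s' => reg s' rV = k /\ forall j,
    arr s' Subset j = if i * q <= j < i * q + k then arr s Comb (j - i * q) else arr s Subset j)) => //.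
  + by apply: ready_setr => //; lia.
  + split=> // j; rewrite !evalE addn0; case: ifP => //; lia.
  + move=> k s' lek rs' fr' [ek ej]; have [_ eb'] := rs'; have [fr'r _ fr'a] := fr'.
    split; first by rewrite !evalE ek; lia.
    move=> ltk; have eC : arr s' Comb k = arr s Comb k by rewrite fr'a.
    apply: wp_seq0; apply: (wp_write base (i := i * q + k) (v := arr s Comb k)) => //.
    * by rewrite !evalE fr'r // !evalE /= eI ek.
    * by rewrite (eval_cell base) // !evalE ek.
    * by have := clt k ltk; lia.
    apply: (wp_assign (v := k.+1)); [by rewrite !evalE ek addn1 | by lia |].
    split=> // j; rewrite !evalE /= ej; case: (eqVneq j (i * q + k)) => [->|nj].
      by rewrite addKn leq_addr addnS ltnSn.
    by rewrite addnS; congr (if _ then _ else _); lia.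
  + move=> s' rs' fr' [_ ej] i'; rewrite ltnS leq_eqVlt => /predU1P[->|lti'].
      have E k : k < q -> arr s' Subset (i * q + k) = arr s Comb k.
        by move=> ltk; rewrite ej leq_addr ltn_add2l ltk addKn.
      split; last by rewrite -[RHS]cidx; apply: eq_bigr => k _; rewrite E.
      by split=> k ltk; rewrite !E; auto; lia.
    have E k : k < q -> arr s' Subset (i' * q + k) = arr s Subset (i' * q + k).
      by move=> ltk; rewrite ej; case: ifP => //; nia.
    have [[h1 h2] h3] := prev i' lti'.
    split; last by rewrite -[RHS]h3; apply: eq_bigr => k _; rewrite E.
    by split=> k ltk; rewrite !E; auto; lia.
- move=> s rs fr eI h; apply: (wp_assign (v := N)) => //.
  exact: ltnW.
Qed.

Lemma wp_pascal s0 : ready s0 -> loaded s0 -> reg s0 rN = N ->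
  (forall i, arr s0 Binom i = 0) ->
  wp pascal (fun s => forall b a, b <= p -> a < N -> a < b + (N - p) ->
     arr s Binom (b * N + a) = 'C(a, b))
   ((N - p) * 1 + p * ((N - p) * 1).+1) s0.
Proof.
move=> rs0 ld0 eN zero; have [eP _ _ _] := ld0.
have p_lt : p < B by lia.
apply: wp_seq0; apply: (wp_assign (v := 0)) => //; first by lia.
apply: (@wp_seq _ ((N - p) * 1) (p * ((N - p) * 1).+1)) => //.
apply: (wp_while_const base (N - p) (fun c s => reg s rC = c /\
   forall i, arr s Binom i = (i < c))) => //.
- by apply: ready_setr => //; lia.
- move=> c s lec rs [frr _ _] [ec eb]; have [_ ebs] := rs.
  split; first by rewrite !evalE ec !frr // !evalE /= eN eP; lia.
  move=> ltc; apply: wp_seq0; apply: (wp_write base (i := c) (v := 1)) => //; first by lia.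
  apply: (wp_assign (v := c.+1)); [by rewrite !evalE ec addn1 | by lia |].
  split=> // i; rewrite !evalE /= eb ltnS.
  by case: (ltngtP i c).
move=> s1 rs1 fr1 [_ eb1].
apply: wp_seq0; apply: (wp_assign (v := 0)) => //; first by lia.
(* The cells that are final once the rows up to [b] are complete and row [b.+1] has [c] new entries.
   [table] also records that the other cells are still 0. *)
pose known b c b' a := (b' <= b) && (a < b' + (N - p)) || (b' == b.+1) && (a < b' + c).
pose table b c s := forall b' a, a < N -> b' <= p ->
  arr s Binom (b' * N + a) = if known b c b' a then 'C(a, b') else 0.
apply: (wp_while_const base p (fun b s => reg s rB = b /\ table b 0 s)) => //.
- by apply: ready_setr => //; lia.
- split=> // b' a lta leb'; rewrite !evalE eb1 /known addn0.
  case: b' leb' => [|b'] leb'; first by rewrite mul0n !add0n bin0 leqnn orbF; case: ltnP.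
  have -> : (b'.+1 * N + a < N - p) = false by lia.
  case: ifP => // cond; rewrite bin_small //; lia.
- move=> b s leb rs fr [eb tab]; have [_ ebs] := rs; have [frr _ _] := fr.
  have [fr1r _ _] := fr1.
  have ePs : reg s rP = p by rewrite frr // !evalE fr1r.
  have eNs : reg s rN = N by rewrite frr // !evalE fr1r.
  split; first by rewrite !evalE ePs eb; lia.
  move=> ltb; apply: wp_seq0; apply: (wp_assign (v := 0)) => //; first by lia.
  apply: (@wp_seq _ ((N - p) * 1) 0); first by rewrite addn0.
  apply: (wp_while_const base (N - p) (fun c s => reg s rC = c /\ table b c s)) => //.
  + by apply: ready_setr => //; lia.
  + move=> c s2 lec rs2 [fr2r _ _] [ec tab2]; have [_ ebs2] := rs2.
    have eP2 : reg s2 rP = p by rewrite fr2r.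
    have eN2 : reg s2 rN = N by rewrite fr2r.
    have eb2 : reg s2 rB = b by rewrite fr2r.
    split; first by rewrite !evalE ec eN2 eP2; lia.
    move=> ltc; have lta : b + c + 1 < N by lia.
    apply: wp_seq0.
    apply: (wp_write base (i := b.+1 * N + (b + c + 1)) (v := 'C((b + c).+1, b.+1))) => //.
    * by rewrite !evalE eb2 eN2 ec addn1.
    * rewrite /binom_at eval_add !(eval_cell base) // !evalE eb2 eN2 ec addn1.
      rewrite !tab2 //; try lia.
      (* For [c = 0] this cell was never written: it lies left of the band and its 0 serves as
         ['C(b, b.+1)]. *)
      have -> : known b c b.+1 (b + c) by rewrite /known; lia.
      have -> : known b c b (b + c) by rewrite /known; lia.
      by rewrite binS.
    * rewrite -addSn; apply: (@leq_ltn_trans 'C(N, p)); last by lia.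
      have -> : 'C(N, p) = 'C(p + (N - p), p) by congr 'C(_, _); lia.
      by apply: leq_bin_add => //; lia.
    apply: (wp_assign (v := c.+1)); [by rewrite !evalE ec addn1 | by lia |].
    split=> // b' a lta' leb'; rewrite !evalE /= eqn_index // addn1.
    case: (boolP (_ && _)) => [/andP[/eqP-> /eqP->]|nab].
      by have -> : known b c.+1 b.+1 (b + c).+1 by rewrite /known; lia.
    rewrite tab2 //; congr (if _ then _ else _); rewrite /known; lia.
  + move=> s2 rs2 [fr2r _ _] [ec tab2].
    apply: (wp_assign (v := b.+1)); [by rewrite !evalE fr2r // !evalE /= eb addn1 | by lia |].
    split=> // b' a lta leb'; rewrite !evalE tab2 // /known addn0.
    case: ifP => c1; case: ifP => c2 //; first by lia.
    by rewrite bin_small //; lia.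
- move=> s rs fr [_ tab] b a leb lta lta'; rewrite tab // /known leb lta' //.
Qed.

Hypothesis es_uniq : forall i, uniq (edge_at i).
Hypothesis es_lt : forall i v, v \in edge_at i -> v < n.
Hypothesis offset_base : offset es m <= base.
Hypothesis pq_B : p * q < B.
Variable L : nat -> nat -> nat.
Hypothesis L_lt : forall i k, i < N -> k < q -> L i k < n.

Definition listed (s : state) : Prop :=
  forall i k, i < N -> k < q -> arr s Subset (i * q + k) = L i k.

Definition multiplicity (t : nat -> nat) (v : nat) : nat :=
  \sum_(j < p) \sum_(k < q) (L (t j) k == v).

(** Each of the [p * q] pairs (listed subset, element of it) adds 1 to the weight of one vertex, and
    an edge collects the full total only if it contains every subset. Counting pairs makes the
    threshold the same however much the subsets overlap. *)
Definition contains (t : nat -> nat) : pred nat :=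
  fun i => p * q <= \sum_(v <- edge_at i) multiplicity t v.

Lemma eq_multiplicity t u : (forall j, j < p -> t j = u j) ->
  multiplicity t =1 multiplicity u.
Proof. by move=> eqt v; apply: eq_bigr => j _; rewrite eqt. Qed.

Lemma eq_contains t u : (forall j, j < p -> t j = u j) -> contains t =1 contains u.
Proof.
by move=> eqt i; congr (_ <= _); apply: eq_bigr => v _; apply: eq_multiplicity.
Qed.

Lemma sum_bool_leq l (b : nat -> bool) : \sum_(i < l) b i <= l.
Proof.
rewrite -[X in _ <= X]card_ord -sum1_card leq_sum // => i _.
exact: leq_b1.
Qed.

(** Each pair [(j, k)] is counted at one vertex at most. The bound keeps the sums formed by
    [collect] within a word. *)
Lemma sum_multiplicity t : \sum_(v < n) multiplicity t v <= p * q.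
Proof.
rewrite exchange_big; apply: (@leq_trans (\sum_(j < p) q)); last first.
  by rewrite sum_nat_const card_ord.
apply: leq_sum => j _; rewrite exchange_big.
apply: (@leq_trans (\sum_(k < q) 1)); last by rewrite sum1_card card_ord.
apply: leq_sum => k _ /=.
case: (ltnP (L (t j) k) n) => [lt|ge].
  rewrite (bigD1 (Ordinal lt)) //= eqxx big1 // => v nv.
  by case: eqP => // eq; case/negP: nv; apply/eqP/val_inj.
by rewrite big1 // => v _; case: eqP => // eq; have := ltn_ord v; lia.
Qed.

Lemma wp_mark s0 r t : ready s0 -> loaded s0 -> listed s0 -> reg s0 rIdx = r ->
  (forall j, j < p -> arr s0 Comb j = t j /\ t j < N) ->
  (forall v, v < n -> arr s0 Mult (r * n + v) = 0) ->
  wp (mark q) (fun s =>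
      (forall v, v < n -> arr s Mult (r * n + v) = multiplicity t v) /\
      (forall j, ~~ (r * n <= j < r * n + n) -> arr s Mult j = arr s0 Mult j))
    (p * (q * 1).+1) s0.
Proof.
move=> rs0 ld0 ls0 er et zero; have leqn := leqn_q; have q_B : q < B by lia.
have p_B : p < B by lia.
apply: wp_seq0; apply: (wp_assign (v := 0)) => //; first by lia.
pose row s f := (forall v, v < n -> arr s Mult (r * n + v) = f v) /\
   (forall j, ~~ (r * n <= j < r * n + n) -> arr s Mult j = arr s0 Mult j).
pose part j v := \sum_(j' < j) \sum_(k < q) (L (t j') k == v).
apply: (wp_while_const base p (fun j s => reg s rJ = j /\ row s (part j))) => //.
- by apply: ready_setr => //; lia.
- by split=> //; split=> // v ltv; rewrite /part big_ord0 evalE zero.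
- move=> j s lej rs fr [ej [row1 row2]]; have [_ eb] := rs; have [frr _ fra] := fr.
  have ld : loaded s by apply: loaded_frame fr _ => //.
  have [eP _ _ _] := ld; split; first by rewrite !evalE eP ej; lia.
  move=> ltj; have [etj lttj] := et j ltj.
  apply: wp_seq0; apply: (wp_assign (v := 0)) => //; first by lia.
  apply: (@wp_seq _ (q * 1) 0); first by lia.
  apply: (wp_while_const base q (fun k s' => reg s' rV = k /\
     row s' (fun v => part j v + \sum_(k' < k) (L (t j) k' == v)))) => //.
  + by apply: ready_setr => //; lia.
  + split=> //; split=> [v ltv|j' nj'].
      by rewrite big_ord0 addn0 evalE row1.
    by rewrite evalE row2.
  + move=> k s1 lek rs1 fr1 [ek [row1' row2']]; have [_ eb1] := rs1.
    have [fr1r _ fr1a] := fr1; have ld1 : loaded s1 by apply: loaded_frame fr1 _.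
    have [_ eV1 _ _] := ld1.
    split; first by rewrite !evalE ek; lia.
    move=> ltk; set v := L (t j) k; have ltv : v < n by apply: L_lt.
    have evE : eval s1 ($rIdx |*| $rVert |+| cell Subset (cell Comb $rJ |*| #q |+| $rV))
        = r * n + v.
      rewrite eval_add (eval_cell base) // !evalE (eval_cell base) // !evalE.
      have -> : reg s1 rIdx = r by rewrite fr1r // !evalE frr.
      have -> : reg s1 rJ = j by rewrite fr1r.
      have -> : arr s1 Comb j = t j by rewrite fr1a // !evalE fra // !evalE.
      by rewrite eV1 ek fr1a // !evalE fra // !evalE ls0.
    have lt1 : (arr s1 Mult (r * n + v)).+1 <= p * q.
      rewrite row1' // /part; apply: (@leq_trans (j * q + k).+1); last by nia.
      rewrite ltnS leq_add ?(sum_bool_leq k (fun k' => L (t j) k' == v)) //.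
      apply: (@leq_trans (\sum_(j' < j) q)); last by rewrite sum_nat_const card_ord.
      apply: leq_sum => i _; exact: (sum_bool_leq q (fun k' => L (t i) k' == v)).
    apply: wp_seq0; apply: (wp_write base (i := r * n + v)
      (v := (arr s1 Mult (r * n + v)).+1)) => //.
    * by rewrite eval_add (eval_cell base) // evE addn1.
    * by lia.
    apply: (wp_assign (v := k.+1)); [by rewrite !evalE ek addn1 | by lia |].
    split=> //; split=> [u ltu|j' nj'].
    * rewrite !evalE /= eqn_add2l big_ord_recr /= addnA -/v !row1' //.
      case: (eqVneq u v) => [->|nuv] /=; first by rewrite addn1.
      by rewrite addn0.
    * rewrite !evalE /=; case: eqP => [ej'|_]; last exact: row2'.
      by case/negP: nj'; rewrite ej' leq_addr ltn_add2l.
  + move=> s1 rs1 [fr1r _ _] [_ [row1' row2']].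
    apply: (wp_assign (v := j.+1)); [by rewrite !evalE fr1r // !evalE /= ej addn1 | by lia |].
    split=> //; split=> [v ltv|j' nj']; rewrite !evalE; last exact: row2'.
    by rewrite row1' // /part big_ord_recr.
- by move=> s rs fr [_].
Qed.

(** A rank determines a combination only on the indices below [p], hence the quantification over all
    functions [t] of that rank. *)
Definition rows_filled (s : state) (c : nat) : Prop :=
  forall i t, i < c -> combination N p t -> colex p t = i ->
  row_of s i (contains t).

(** Rows that have not been reached still hold the initial zeros, in [Mult] as well, because every
    row works in its own slice of width [n]. Thus nothing has to be reset between two rows. *)
Lemma wp_fill_rows s0 : ready s0 -> loaded s0 -> listed s0 -> reg s0 rN = N ->
  (forall k i, acode k < 4 -> arr s0 k i = 0) ->
  wp (fill_rows q) (fun s => rows_filled s 'C(N, p))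
   (p + 'C(N, p) * (p * (q * 1).+1 + \sum_(i < m) (2 * size (edge_at i)).+1 + p).+1) s0.
Proof.
move=> rs0 ld0 ls0 eN0 zero; have [eP0 _ _ _] := ld0.
have p_B : p < B by lia.
apply: wp_seq0; apply: (wp_assign (v := p)) => //.
apply: wp_seq0; apply: (wp_assign (v := N)) => //; first by lia.
apply: wp_seq0; apply: (wp_assign (v := p * q)) => //; first by rewrite !evalE eP0.
pose Inv i s := rows_filled s i /\ forall r, i <= r ->
  row_clear base n s r /\ forall v, v < n -> arr s Mult (r * n + v) = 0.
apply: (@wp_combinations B base _ p N Inv) => //.
- by do 3!(apply: ready_setr; [by [] | by lia |]).
- exact: ltnW.
- by lia.
- move=> i s s' fr [h1 h2]; split=> [i' t lti ct et|r ler].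
    by apply: row_of_frame fr _ => //; apply: h1.
  have [[cT cP cC] cM] := h2 r ler; have [_ _ fa] := fr.
  by split; [split|]; try move=> v ltv; rewrite fa // ?cC ?cM.
- split=> // r _; split; first split.
  + by rewrite !evalE; apply: zero.
  + by rewrite !evalE; apply: zero.
  + by move=> v _; rewrite !evalE; apply: zero.
  + by move=> v _; rewrite !evalE; apply: zero.
- move=> i s lti rs fr eI ct ec [h1 h2]; have [frr _ fra] := fr.
  have ld : loaded s.
    by apply: loaded_frame fr _ => //; do 3!apply: loaded_setr => //.
  have ls : listed s by move=> i' k lti' ltk; rewrite fra // !evalE ls0.
  have [cl cM] := h2 i (leqnn i); set t := contents base s Comb in ct ec.
  apply: wp_seq (leqnn _) _.
  have et j : j < p -> arr s Comb j = t j /\ t j < N.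
    by move=> ltj; split=> //; case: ct => _; apply.
  apply: wp_conseq (wp_frame base (erefl : wf (mark q)) rs (wp_mark rs ld ls eI et cM)) _.
  move=> s1 [rs1 fr1 [row1 out1]]; have [fr1r _ fr1a] := fr1.
  have ld1 : loaded s1 by apply: loaded_frame fr1 _.
  have eTg : reg s1 rTarget = p * q by rewrite fr1r // frr.
  have eI1 : reg s1 rIdx = i by rewrite fr1r.
  have cl1 : row_clear base n s1 i.
    by case: cl => cT cP cC; split; try move=> v ltv; rewrite fr1a // cC.
  have ltmu : \sum_(v < n) multiplicity t v < B.
    by apply: leq_ltn_trans (sum_multiplicity t) _.
  apply: wp_conseq (wp_frame base (erefl : wf collect) rs1 (wp_collect es_uniq es_lt offset_base
    base_B rs1 ld1 eI1 eTg row1 cl1 ltmu)) _.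
  move=> s2 [rs2 [_ _ fr2a] [row2 [oT oP oC]]].
  have disj r v : r != i -> v < n -> ~~ (i * n <= r * n + v < i * n + n) by nia.
  split=> [i' u lti' cu eu|r ltr].
    move: lti'; rewrite ltnS leq_eqVlt => /predU1P[ei'|lti'].
      rewrite ei'; apply: row_of_eq row2 => i0 _.
      apply: eq_contains => j ltj; apply: (colex_inj (proj1 ct) (proj1 cu) _ ltj).
      by rewrite ec eu ei'.
    have ni : i' != i by lia.
    have [eT eC ep] := h1 i' u lti' cu eu.
    split=> [|v ltv|].
    + by rewrite oT // fr1a.
    + by rewrite oC ?disj // fr1a // eC.
    + by rewrite oP // fr1a.
  have ni : r != i by lia.
  have [[cT cP cC] cM'] := h2 r (ltnW ltr).
  split; first split.
  + by rewrite oT // fr1a.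
  + by rewrite oP // fr1a.
  + by move=> v ltv; rewrite oC ?disj // fr1a // cC.
  + by move=> v ltv; rewrite fr2a // out1 ?disj // cM'.
- by move=> s rs fr _ [].
Qed.

Definition pascal_table (s : state) : Prop :=
  forall b a, b <= p -> a < N -> a < b + (N - p) ->
  arr s Binom (b * N + a) = 'C(a, b).

Definition selection (t : nat -> nat) (J : nat) (s : state) : Prop :=
  (forall j, j < J -> arr s Row j = colex p (skip t j)) /\
  ((reg s rEdge = 0 /\ forall j i, j < J -> i < m -> ~~ contains (skip t j) i) \/
   exists j i, [/\ j < J, i < m, contains (skip t j) i & reg s rEdge = offset es i]).

Lemma wp_select_rows s0 t : ready s0 -> loaded s0 -> reg s0 rN = N ->
  combination N p.+1 t -> (forall i, i <= p -> arr s0 Comb i = t i) ->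
  pascal_table s0 -> rows_filled s0 'C(N, p) ->
  wp select_rows (selection t p.+1) (p * 1 + p * 1) s0.
Proof.
move=> rs0 ld0 eN0 ct et tab rows; have [eP0 _ _ _] := ld0.
have p_B : p < B by lia.
have skip_lt j : colex p (skip t j) < 'C(N, p).
  exact/colex_ltn/combination_skip.
have t_lt i : i <= p -> t i < N by move=> lei; case: ct => _; apply.
(* The lookups use [a = b] or [a = b.-1], and [t a < a + (N - p)] by [combination_leq]; hence they
   stay inside the band. *)
have read s b a : frame [:: rX; rJ; rEdge] [:: acode Row] s0 s ->
  0 < b <= p -> a <= b -> b.-1 <= a ->
  arr s Binom (b * N + t a) = 'C(t a, b).
  move=> [_ _ fa] /andP[b_gt0 leb] lea gea; rewrite fa // tab ?t_lt //; first by lia.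
  have := @combination_leq N p t a ct; lia.
have sub (c : cmd) s s' : all (mem [:: rX; rJ; rEdge]) (modR c) &&
    all (mem [:: acode Row]) (modA c) -> frame (modR c) (modA c) s s' ->
    frame [:: rX; rJ; rEdge] [:: acode Row] s s' by exact: frame_all.
apply: wp_seq0; apply: (wp_assign (v := 0)) => //; first by lia.
apply: wp_seq0; apply: (wp_assign (v := 0)) => //; first by lia.
apply: (@wp_seq _ (p * 1) (p * 1)) => //.
set s1 := setr _ _ _.
have fr01 : frame [:: rX; rJ; rEdge] [:: acode Row] s0 s1.
  split=> // x; rewrite !inE !negb_or => /and3P[/negPf nX /negPf nJ _].
  by rewrite !evalE nX nJ.
apply: (wp_while_const base p (fun j s => reg s rJ = j /\
   reg s rX = \sum_(i < j) 'C(t i.+1, i.+1))) => //.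
- by do 2!(apply: ready_setr => //; first by lia).
- by rewrite big_ord0.
- move=> j s lej rs /sub fr [ej ex]; have [_ eb] := rs.
  have fr0 := frame_trans fr01 (fr isT); have [frr _ fra] := fr0.
  split; first by rewrite !evalE ej frr // eP0; lia.
  move=> ltj; have exS : \sum_(i < j.+1) 'C(t i.+1, i.+1) =
    \sum_(i < j) 'C(t i.+1, i.+1) + 'C(t j.+1, j.+1) by rewrite big_ord_recr.
  apply: wp_seq0; apply: (wp_assign (v := \sum_(i < j.+1) 'C(t i.+1, i.+1))).
  + rewrite eval_add /binom_at (eval_cell base) // !evalE (eval_cell base) // !evalE.
    have eC : arr s Comb j.+1 = t j.+1 by rewrite fra ?et.
    by rewrite ej ex exS frr // eN0 addn1 eC (read s).
  (* The partial sums that are stored are bounded by the complete rank, itself below ['C(N, p)]. *)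
  + apply: (@leq_ltn_trans (colex p (skip t 0))); last by have := skip_lt 0; lia.
    rewrite /colex -(subnK ltj) addnC big_split_ord /=.
    by apply: leq_trans (leq_addr _ _); apply: eq_leq; apply: eq_bigr.
  apply: (wp_assign (v := j.+1)); [by rewrite !evalE ej addn1 | by lia |].
  by rewrite !evalE.
move=> s2 rs2 /sub fr2 [_ ex2].
have {fr2} fr02 := frame_trans fr01 (fr2 isT).
have ex0 : reg s2 rX = colex p (skip t 0) by rewrite ex2; apply: eq_bigr.
apply: wp_seq0; apply: (wp_assign (v := 0)) => //; first by lia.
apply: wp_seq0; apply: (wp_assign (v := 0)) => //; first by lia.
pose Inv j s := [/\ reg s rJ = j, reg s rX = colex p (skip t j) & selection t j.+1 s].
have put j s : ready s -> frame [:: rX; rJ; rEdge] [:: acode Row] s0 s ->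
    reg s rJ = j -> reg s rX = colex p (skip t j) -> j <= p -> selection t j s ->
    wp put_row (Inv j) 0 s.
  move=> rs fr ej ex lej [row edge]; have [_ eb] := rs.
  have [eT eC eP] : row_of s0 (colex p (skip t j)) (contains (skip t j)).
    by apply: rows => //; apply: combination_skip.
  apply: wp_seq0; apply: (wp_write base (i := j) (v := colex p (skip t j))) => //.
    by have := skip_lt j; lia.
  set s3 := seta _ _ _ _ _.
  have row3 j' : j' < j.+1 -> arr s3 Row j' = colex p (skip t j').
    rewrite evalE /= ltnS leq_eqVlt; case: eqP => [-> //|_] /= ltj'.
    exact: row.
  have ePtr : eval s3 (cell Ptr $rX) = arr s0 Ptr (colex p (skip t j)).
    rewrite (eval_cell base) // !evalE /= ex; case: fr => _ _ -> //.
  apply: wp_if; rewrite ePtr => tst.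
  - case: eP => [[e0 _]|[i [lti ci ei]]]; first by rewrite e0 in tst.
    apply: (wp_assign (v := offset es i)); first by rewrite ePtr ei.
      by have := offset_lt offset_base lti; lia.
    split; rewrite ?evalE //; split=> [j' ltj'|]; first by rewrite evalE row3.
    by right; exists j, i; rewrite !evalE.
  - case: eP => [[_ no]|[i [_ _ ei]]]; last by rewrite ei in tst.
    apply: wp_skip; split=> //; split=> //.
    case: edge => [[e0 nc]|[j' [i [ltj' lti ci ei]]]]; [left|right].
      split=> // j' i; rewrite ltnS leq_eqVlt => /predU1P[->|]; last exact: nc.
      exact: no.
    by exists j', i; rewrite !evalE ltnW.
apply: (@wp_seq _ 0 (p * 1)) => //.
set s3 := setr _ _ _.
have fr23 : frame [:: rX; rJ; rEdge] [:: acode Row] s2 s3.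
  split=> // x; rewrite !inE !negb_or => /and3P[_ /negPf nJ /negPf nE].
  by rewrite !evalE nE nJ.
have rs3 : ready s3 by do 2!(apply: ready_setr => //; first by lia).
have sel3 : selection t 0 s3 by split=> //; left.
have fr03 := frame_trans fr02 fr23.
apply: wp_conseq (wp_frame base (erefl : wf put_row) rs3 (put 0 s3 rs3 fr03 _ _ _ sel3)) _ => //.
move=> s4 [rs4 /sub fr4 inv4]; have {fr4} fr04 := frame_trans fr03 (fr4 isT).
apply: (wp_while_const base p Inv) => //.
- move=> j s lej rs /sub fr [ej ex sel]; have [_ eb] := rs.
  have {fr} fr0 := frame_trans fr04 (fr isT); have [frr frm fra] := fr0.
  split; first by rewrite !evalE ej frr // eP0; lia.
  move=> ltj; have skS := colex_skipS t ltj; have := skip_lt j.+1; have := skip_lt j.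
  move=> lt1 lt2.
  apply: wp_seq0; apply: (wp_assign (v := colex p (skip t j.+1))); last 2 first.
  + by lia.
  + apply: wp_seq0; apply: (wp_assign (v := j.+1)); [by rewrite !evalE ej addn1 | by lia |].
    apply: put => //.
    * by do 2!(apply: ready_setr; [by [] | by lia |]).
    * split=> // x xn; rewrite !evalE -frr //.
      by move: xn; rewrite !inE !negb_or => /and3P[/negPf-> /negPf-> _].
  rewrite eval_sub eval_add /binom_at !(eval_cell base) // !evalE !(eval_cell base) // !evalE.
  have [eC1 eC2] : arr s Comb j = t j /\ arr s Comb j.+1 = t j.+1.
    by split; rewrite fra // et // ltnW.
  by rewrite ej ex frr // eN0 addn1 eC1 eC2 !(read s) //; lia.
- by move=> s rs fr [].
Qed.

Definition counterexample (t : nat -> nat) : bool :=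
  small_core n es q p.+1 (fun j => contains (skip t j)).

Lemma eq_counterexample t u : (forall i, i <= p -> t i = u i) ->
  counterexample t = counterexample u.
Proof.
move=> eqt; have eqc j i : contains (skip t j) i = contains (skip u j) i.
  apply: eq_contains => k ltk; apply: eqt; rewrite /bump; case: (j <= k); lia.
rewrite /counterexample /small_core; congr (~~ _ && (_ < _)).
  by apply: eq_all => j; apply: eq_all => i; rewrite eqc.
by apply: eq_count => v; apply: eq_all => j; apply: eq_all => i; rewrite eqc.
Qed.

Hypothesis CNp1_B : 'C(N, p.+1) < B.

Lemma wp_check_all s0 R : ready s0 -> loaded s0 -> reg s0 rN = N ->
  pascal_table s0 -> rows_filled s0 'C(N, p) ->
  (forall i, i < m -> size (edge_at i) <= R) ->
  wp (check_all q) (fun s => exists a : bool, reg s rAns = a /\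
     (a <-> forall t, combination N p.+1 t -> ~~ counterexample t))
   (p.+1 + 'C(N, p.+1) * ((p * 1 + p * 1) + R * p.+2 + p.+1).+1) s0.
Proof.
move=> rs0 ld0 eN0 tab rows leR; have [eP0 _ _ _] := ld0.
have p1_B : p.+1 < B by lia.
apply: wp_seq0; apply: (wp_assign (v := p.+1)) => //; first by rewrite !evalE eP0 addn1.
apply: wp_seq0; apply: (wp_assign (v := N)) => //; first by lia.
apply: wp_seq0; apply: (wp_assign (v := p.+1)) => //; first by rewrite !evalE /= eP0 addn1.
apply: wp_seq0; apply: (wp_assign (v := 1)) => //; first by lia.
set s1 := setr _ _ _.
have R1 x : reg s1 x = if x == rAns then 1 else if x == rRows then p.+1 else
   if x == rTop then N else if x == rSize then p.+1 else reg s0 x by rewrite !evalE.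
have A1 k i : arr s1 k i = arr s0 k i by rewrite !evalE.
have rs1 : ready s1 by do 4!(apply: ready_setr; [by [] | by lia |]).
have ld1 : loaded s1 by do 4!apply: loaded_setr => //.
clearbody s1.
pose Inv c s := exists a : bool, reg s rAns = a /\
   (a <-> forall t, combination N p.+1 t -> colex p.+1 t < c -> ~~ counterexample t).
apply: (@wp_combinations B base _ p.+1 N Inv) => //.
- by move=> c s s' [frr _ _] [a [ea aP]]; exists a; rewrite frr.
- by exists true; rewrite R1.
- move=> c s ltc rs fr eI ct ec [a [ea aP]]; have [frr _ fra] := fr.
  have ld : loaded s by apply: loaded_frame fr ld1.
  set t := contents base s Comb in ct ec.
  have eN : reg s rN = N by rewrite frr // R1.
  have tab' : pascal_table s by move=> b i *; rewrite fra // A1 tab.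
  have rows' : rows_filled s 'C(N, p).
    move=> i u lti cu eu; have [eT eC eP] := rows i u lti cu eu.
    split=> [|v ltv|]; rewrite fra // A1 //; exact: eC.
  have et i : i <= p -> arr s Comb i = t i by [].
  apply: wp_seq (leqnn _) _.
  apply: wp_conseq (wp_frame base (erefl : wf select_rows) rs
    (wp_select_rows rs ld eN ct et tab' rows')) _.
  move=> s2 [rs2 fr2 [row2 edge2]]; have [fr2r _ fr2a] := fr2.
  have ld2 : loaded s2 by apply: loaded_frame fr2 ld.
  have eJ2 : reg s2 rRows = p.+1 by rewrite fr2r // frr // R1.
  have ea2 : reg s2 rAns = a by rewrite fr2r.
  have row2' j : j < p.+1 -> arr s2 Row j = colex p (skip t j) /\
     row_of s2 (colex p (skip t j)) (contains (skip t j)).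
    move=> ltj; split; first exact: row2.
    apply: row_of_frame fr2 _ => //; have csk := combination_skip j ct.
    by apply: rows' => //; apply: colex_ltn.
  apply: wp_conseq (wp_check (I := fun j => colex p (skip t j))
    (F := fun j => contains (skip t j)) es_uniq es_lt offset_base base_B q rs2 ld2 eJ2 ea2
    row2' p1_B leR edge2) _ => s3 ea3.
  exists (a && ~~ counterexample t); split=> //; split.
    case/andP=> /aP prev nct u cu; rewrite ltnS leq_eqVlt => /predU1P[eu|]; last exact: prev.
    rewrite -(@eq_counterexample t) // => i lei.
    by apply: (colex_inj (proj1 ct) (proj1 cu)) => //; rewrite ec eu.
  move=> h; apply/andP; split; last by apply: h; rewrite ?ec.
  by apply/aP => u cu ltu; apply: h; rewrite // ltnW.
- move=> s rs fr _ [a [ea aP]]; exists a; split=> //; rewrite aP.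
  by split=> h t ct; [apply: h; rewrite // colex_ltn | move=> _; apply: h].
Qed.

End Phases.

(** * A criterion for the Helly property *)

Section Helly.

Variable H : hypergraph.
Implicit Types (J K : {set 'I_(nedges H)}) (A : {set vertex H}).

Lemma core_subset J K : J \subset K -> core K \subset core J.
Proof.
move=> sJK; apply/subsetP => x /bigcapP xK; apply/bigcapP => i iJ.
by apply: xK; apply: (subsetP sJK).
Qed.

Lemma core1 i : core [set i] = edge (h := H) i.
Proof. by rewrite /core big_set1. Qed.

Lemma subset_core A J : (forall i, i \in J -> A \subset edge (h := H) i) -> A \subset core J.
Proof. by move=> sub; apply/bigcapsP. Qed.

Lemma intersecting_subset p q J K : J \subset K -> intersecting p q K ->
  intersecting p q J.
Proof.
move=> sJK /forallP h; apply/forallP => L; apply/implyP => /and3P[nL sL leL].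
by have /implyP := h L; apply; rewrite nL (subset_trans sL sJK).
Qed.

Lemma intersectingP p q J : reflect
  (forall K, K != set0 -> K \subset J -> #|K| <= p -> q <= #|core K|)
  (intersecting p q J).
Proof.
apply: (iffP forallP) => [h K nK sK leK|h K].
  by have /implyP := h K; apply; rewrite nK sK.
by apply/implyP => /and3P[]; apply: h.
Qed.

Lemma hellyP p q : reflect
  (forall J, J != set0 -> intersecting p q J -> q <= #|core J|)
  (helly p q H).
Proof.
apply: (iffP forallP) => [h J nJ iJ|h J].
  by have /implyP := h J; apply; rewrite nJ.
by apply/implyP => /andP[]; apply: h.
Qed.

Variables (p q N : nat) (qs : nat -> {set vertex H}).
Hypothesis p_gt0 : 0 < p.
Hypothesis card_qs : forall a, a < N -> #|qs a| = q.
Hypothesis qs_surj : forall A, #|A| = q -> exists2 a, a < N & A = qs a.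

Definition support (t : nat -> nat) : {set 'I_(nedges H)} :=
  [set i | [exists j : 'I_p.+1, [forall k : 'I_p, qs (skip t j k) \subset edge i]]].

Lemma supportP t i : reflect
  (exists2 j, j <= p & forall k, k <= p -> k != j -> qs (t k) \subset edge i)
  (i \in support t).
Proof.
rewrite inE; apply: (iffP existsP) => [[j /forallP sub]|[j lej sub]].
  exists j => [|k lek nk]; first by rewrite -ltnS.
  have ltk : unbump j k < p by have := ltn_ord j; rewrite /unbump; lia.
  have := sub (Ordinal ltk); rewrite /skip /=.
  by have -> : bump j (unbump j k) = k by rewrite /bump /unbump; lia.
have ltj : j < p.+1 by [].
exists (Ordinal ltj); apply/forallP => k; apply: sub => /=.
  by have := ltn_ord k; rewrite /bump; case: (j <= k); lia.
by rewrite /bump; case: (leqP j k); lia.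
Qed.

(* [p] edges of the support miss at most [p] of the [p + 1] numbered sets, so
   they all contain the remaining one. *)
Lemma intersecting_support t : (forall j, j <= p -> t j < N) ->
  intersecting p q (support t).
Proof.
move=> ltt; apply/intersectingP => K _ sK leK.
have omitP i : exists j : 'I_p.+1, (i \in K) ==>
    [forall k : 'I_p.+1, (k != j) ==> (qs (t k) \subset edge i)].
  have [iK|] := boolP (i \in K); last by exists ord0.
  have /supportP[j lej sub] := subsetP sK i iK.
  have ltj : j < p.+1 by []; exists (Ordinal ltj); apply/forallP => k.
  by apply/implyP => nk; apply: sub => //; rewrite -ltnS.
pose omit i := xchoose (omitP i).
have [j0 nj0] : exists j0, j0 \notin omit @: K.
  apply/existsP; rewrite -negb_forall; apply/negP => /forallP all0.
  have : #|'I_p.+1| <= #|omit @: K| by apply/subset_leq_card/subsetP => j _; apply: all0.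
  by rewrite card_ord; have := leq_imset_card omit K; lia.
have lej0 : j0 <= p by rewrite -ltnS.
rewrite -(card_qs (ltt j0 lej0)); apply/subset_leq_card/subset_core => i iK.
have /implyP/(_ iK)/forallP/(_ j0)/implyP := xchooseP (omitP i); apply.
by apply: contra nj0 => /eqP->; apply: imset_f.
Qed.

Lemma core_qs A : q <= #|A| -> exists2 a, a < N & qs a \subset A.
Proof.
move=> leq; have : (0 < #|[set B : {set vertex H} | B \subset A & #|B| == q]|).
  by rewrite cards_draws bin_gt0.
case/card_gt0P => B; rewrite inE => /andP[sBA /eqP cB].
by have [a lta eB] := qs_surj cB; exists a; rewrite // -eB.
Qed.

(** The [q]-subsets attached to the edges of a minimal bad family [J] are distinct: one attached to
    two edges would lie in every edge of [J] and make its core large. Each edge of [J] contains all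
    chosen subsets except possibly its own, so [J] is a subfamily of the support, whose core is
    therefore at most as large. *)
Lemma not_helly_support : ~~ helly p q H ->
  exists t, [/\ combination N p.+1 t, support t != set0 & #|core (support t)| < q].
Proof.
case/forallPn => J0; rewrite negb_imply -ltnNge => badJ0.
pose bad J := (J != set0) && intersecting p q J && (#|core J| < q).
have [J /minsetP[/andP[/andP[nJ iJ] cJ] minJ] _] := @minset_exists _ bad J0 badJ0.
(* With at most [p] members, [J] would be one of the subfamilies tested by its own intersection
   property. *)
have ltpJ : p < #|J|.
  rewrite ltnNge; apply/negP => leJ; move: cJ; rewrite ltnNge => /negP[].
  by apply: (intersectingP _ _ _ iJ).
have /(@fin_all_exists _ _ (fun i a => i \in J -> a < N /\ qs a \subset core (J :\ i))) :
    forall i : 'I_(nedges H), exists a, i \in J -> a < N /\ qs a \subset core (J :\ i).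
  move=> i; have [iJ'|] := boolP (i \in J); last by exists 0.
  have [|a lta sub] := @core_qs (core (J :\ i)); last by exists a.
  rewrite leqNgt; apply/negP => small.
  (* Here [p >= 1] enters: [J] has at least two edges. *)
  have nD : J :\ i != set0.
    rewrite -card_gt0; move: ltpJ; rewrite (cardsD1 i J) iJ' add1n ltnS.
    exact: leq_trans.
  have /minJ : bad (J :\ i).
    by rewrite /bad nD small (intersecting_subset (subD1set J i) iJ).
  by move=> /(_ (subD1set J i)) eqJ; move: iJ'; rewrite -eqJ !inE eqxx.
case=> c cP; have c_inj : {in J &, injective c}.
  move=> i i' iJ1 iJ2 eqc; apply/eqP; apply: contraTT cJ => ni; rewrite -leqNgt.
  have [lti subi] := cP i iJ1; have [_ subi'] := cP i' iJ2.
  rewrite -(card_qs lti); apply/subset_leq_card/subset_core => k kJ.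
  have [eki|nki] := eqVneq k i.
    by rewrite eqc; apply: subset_trans subi' (bigcap_inf _ _); rewrite !inE kJ eki ni.
  by apply: subset_trans subi (bigcap_inf _ _); rewrite !inE nki.
have [I sIJ cI] : exists2 I : {set 'I_(nedges H)}, I \subset J & #|I| = p.+1.
  have : 0 < #|[set B : {set 'I_(nedges H)} | B \subset J & #|B| == p.+1]|.
    by rewrite cards_draws bin_gt0.
  by case/card_gt0P => B; rewrite inE => /andP[sB /eqP cB]; exists B.
pose s := sort leq [seq c i | i <- enum I].
have sz : size s = p.+1 by rewrite size_sort size_map -cardE.
have us : uniq s.
  rewrite sort_uniq map_inj_in_uniq ?enum_uniq // => i i'; rewrite !mem_enum => iI iI'.
  by apply: c_inj; apply: (subsetP sIJ).
have ss : sorted ltn s by rewrite ltn_sorted_uniq_leq us sort_sorted //; apply: leq_total.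
have sP k : k <= p -> exists2 i, i \in I & nth 0 s k = c i.
  move=> lek; have : nth 0 s k \in s by rewrite mem_nth ?sz.
  by rewrite mem_sort => /mapP[i]; rewrite mem_enum; exists i.
have ct : combination N p.+1 (nth 0 s).
  split=> [k ltk|k ltk]; first by apply: (sorted_ltn_nth ltn_trans) => //; rewrite ?inE ?sz; lia.
  by have [i iI ->] := sP k ltk; have [] := cP i (subsetP sIJ i iI).
have sJS : J \subset support (nth 0 s).
  apply/subsetP => e eJ; apply/supportP.
  have sub k i : i \in I -> nth 0 s k = c i -> i != e -> qs (nth 0 s k) \subset edge e.
    move=> iI -> ni; have [_ subi] := cP i (subsetP sIJ i iI).
    by apply: subset_trans subi (bigcap_inf _ _); rewrite !inE eq_sym ni.
  have [/(nthP 0)[j]|nes] := boolP (c e \in s).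
    rewrite sz ltnS => lej ej; exists j => // k lek nk; have [i iI eki] := sP k lek.
    apply: (sub k i) => //; apply: contra nk => /eqP ei.
    by rewrite -(nth_uniq 0 _ _ us) ?sz // eki ei ej.
  exists 0 => // k lek nk; have [i iI eki] := sP k lek.
  apply: (sub k i) => //; apply: contra nes => /eqP <-.
  by rewrite -eki mem_nth // sz.
exists (nth 0 s); split=> //.
  by apply: contraNneq nJ => S0; rewrite -subset0 -S0.
exact: leq_ltn_trans (subset_leq_card (core_subset sJS)) cJ.
Qed.

Lemma helly_support : helly p q H <-> forall t, combination N p.+1 t ->
  ~~ ((support t != set0) && (#|core (support t)| < q)).
Proof.
split=> [/hellyP h t [inc lt]|h].
  apply/negP => /andP[nS]; rewrite ltnNge => /negP[]; apply: h => //.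
  by apply: intersecting_support => j; apply: lt.
by apply: contraT => /not_helly_support[t [ct nS cS]]; have := h t ct; rewrite nS cS.
Qed.

End Helly.

Lemma helly_few_subsets (H : hypergraph) p q : 0 < p ->
  'C(nvertices H, q) <= p -> helly p q H.
Proof.
move=> p_gt0 leNp; set N := 'C(_, q) in leNp; pose D := [set A : {set vertex H} | #|A| == q].
have cD : #|D| = N by rewrite card_draws.
pose qs := nth set0 (enum D).
have sz : size (enum D) = N by rewrite -cardE.
apply: contraT => nh; have [||t [[inc lt] _ _]] := @not_helly_support H p q N qs p_gt0 _ _ nh.
- move=> a lta; have : qs a \in enum D by rewrite mem_nth ?sz.
  by rewrite mem_enum inE => /eqP.
- move=> A cA; have : A \in enum D by rewrite mem_enum inE cA.
  by case/(nthP set0) => a; rewrite sz => lta eA; exists a.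
by have := @increasing_leq _ t 0 p inc; have := lt p (ltnSn p); lia.
Qed.

(** The [(1, q)]-intersecting families are exactly the subfamilies of [S], and the core of [S] is
    contained in the core of each nonempty one. *)
Lemma helly1 (H : hypergraph) q (S := [set i | q <= #|edge (h := H) i|]) :
  helly 1 q H = ~~ ((S != set0) && (#|core S| < q)).
Proof.
rewrite negb_and negbK -leqNgt; apply/hellyP/orP => [h|h J nJ /intersectingP iJ].
  have [->|nS] := eqVneq S set0; [by left | right; apply: h => //].
  apply/intersectingP => K nK sK leK; have /cards1P[i eK] : #|K| == 1.
    by rewrite eqn_leq leK card_gt0.
  by rewrite eK core1; have := subsetP sK i; rewrite eK !inE eqxx => /(_ isT).
have sJS : J \subset S.
  apply/subsetP => i iJ'; rewrite inE -core1; apply: iJ; rewrite ?cards1 ?sub1set //.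
  by apply/set0Pn; exists i; rewrite set11.
case: h => [/eqP S0|leS]; first by case/negP: nJ; rewrite -subset0 -S0.
exact: leq_trans leS (subset_leq_card (core_subset sJS)).
Qed.

Lemma combination_of_set (T : finType) (A : {set T}) :
  exists t, combination #|T| #|A| t /\
    A = [set x | nat_of_ord (enum_rank x) \in [seq t k | k <- iota 0 #|A|]].
Proof.
pose s := sort leq [seq nat_of_ord (enum_rank x) | x <- enum A].
have inj : injective (fun x : T => nat_of_ord (enum_rank x)).
  by move=> x y /val_inj/enum_rank_inj.
have sz : size s = #|A| by rewrite size_sort size_map -cardE.
have us : uniq s by rewrite sort_uniq map_inj_uniq ?enum_uniq.
have ss : sorted ltn s by rewrite ltn_sorted_uniq_leq us sort_sorted //; apply: leq_total.
exists (nth 0 s); split.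
  split=> k ltk; first by apply: (sorted_ltn_nth ltn_trans) => //; rewrite ?inE ?sz; lia.
  have : nth 0 s k \in s by rewrite mem_nth ?sz.
  by rewrite mem_sort => /mapP[x _ ->].
apply/setP => x; rewrite inE -sz -/(mkseq _ _) mkseq_nth mem_sort.
by rewrite (mem_map inj) mem_enum.
Qed.

(** The true and the false entries add up to [p * q], so the threshold is met only if no entry is
    false. *)
Lemma leq_sum2_bool p q (b : nat -> nat -> bool) :
  (p * q <= \sum_(j < p) \sum_(k < q) b j k)
  = [forall j : 'I_p, [forall k : 'I_q, b j k]].
Proof.
have sum1 : \sum_(j < p) \sum_(k < q) b j k + \sum_(j < p) \sum_(k < q) ~~ b j k = p * q.
  rewrite -big_split /=; transitivity (\sum_(j < p) q); last by rewrite sum_nat_const card_ord.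
  apply: eq_bigr => j _; rewrite -big_split /= -[RHS]card_ord -sum1_card.
  by apply: eq_bigr => k _; case: (b j k).
rewrite -sum1 -[X in _ <= X]addn0 leq_add2l leqn0 sum_nat_eq0.
apply: eq_forallb => j; rewrite sum_nat_eq0; apply: eq_forallb => k /=.
by case: (b j k).
Qed.

(** * Reading the encoded input as a hypergraph *)

Section Listing.

Variable H : hypergraph.
Variable l : 'I_(nedges H) -> seq (vertex H).
Hypothesis listing : edge_listing l.

Local Notation n := (nvertices H).
Local Notation index x := (nat_of_ord (enum_rank x)).

Definition edge_seqs : seq (seq nat) :=
  [seq [seq index x | x <- l i] | i <- enum 'I_(nedges H)].
Local Notation es := edge_seqs.

Lemma size_edge_seqs : size es = nedges H.
Proof. by rewrite size_map size_enum_ord. Qed.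

Lemma nth_edge_seqs (i : 'I_(nedges H)) : nth [::] es i = [seq index x | x <- l i].
Proof. by rewrite (nth_map i) ?size_enum_ord // nth_ord_enum. Qed.

(** The empty default makes uniqueness and the range of vertices hold at every index, in or out of
    range. *)
Lemma edge_seqs_default i : nedges H <= i -> nth [::] es i = [::].
Proof. by move=> le; rewrite nth_default // size_edge_seqs. Qed.

Lemma index_inj : injective (fun x : vertex H => index x).
Proof. by move=> x y /val_inj/enum_rank_inj. Qed.

Lemma uniq_edge_seqs i : uniq (nth [::] es i).
Proof.
have [lti|/edge_seqs_default-> //] := ltnP i (nedges H).
rewrite (nth_edge_seqs (Ordinal lti)) map_inj_uniq; last exact: index_inj.
by case: (listing (Ordinal lti)).
Qed.

Lemma edge_seqs_lt i v : v \in nth [::] es i -> v < n.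
Proof.
have [lti|/edge_seqs_default-> //] := ltnP i (nedges H).
by rewrite (nth_edge_seqs (Ordinal lti)) => /mapP[x _ ->]; apply: ltn_ord.
Qed.

Lemma mem_edge_seqs (i : 'I_(nedges H)) x :
  (index x \in nth [::] es i) = (x \in edge i).
Proof.
rewrite nth_edge_seqs (mem_map index_inj).
by have [_ ->] := listing i.
Qed.

Lemma size_nth_edge_seqs (i : 'I_(nedges H)) : size (nth [::] es i) = #|edge (h := H) i|.
Proof.
have [ul eql] := listing i; rewrite nth_edge_seqs size_map -(card_uniqP ul).
exact: eq_card.
Qed.

Lemma encode_input p : encode p l = input p n es.
Proof.
rewrite /encode /input size_edge_seqs; do 3!congr cons; congr flatten.
rewrite /edge_seqs -[RHS]map_comp.
by apply: eq_map => i /=; rewrite size_map.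
Qed.

Lemma count_vertices (P : pred nat) : count P (iota 0 n) = #|[set x : vertex H | P (index x)]|.
Proof.
have -> : count P (iota 0 n) = #|[set y : 'I_n | P y]|.
  rewrite -val_enum_ord count_map enumT cardE /enum_mem size_filter.
  by apply: eq_count => y; rewrite /= inE.
rewrite -[RHS](card_imset _ enum_rank_inj); apply: eq_card => y; rewrite inE.
apply/idP/imsetP => [Py|[x + ->]]; last by rewrite inE.
by exists (enum_val y); rewrite ?inE enum_valK.
Qed.

(** Carries the computed test over to the hypergraph, for any set [S] of edges that is the union of
    the families. *)
Lemma small_coreE q J (F : nat -> pred nat) (S : {set 'I_(nedges H)}) :
  (forall i, reflect (exists2 j, j < J & F j (nat_of_ord i)) (i \in S)) ->
  small_core n es q J F = (S != set0) && (#|core S| < q).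
Proof.
move=> SP; rewrite /small_core; congr (~~ _ && (_ < q)).
  apply/allP/eqP => [h|S0 j].
    apply/setP => i; rewrite inE; apply/SP => -[j ltj Fji].
    have := h j; rewrite mem_iota => /(_ ltj)/allP/(_ i).
    by rewrite mem_iota size_edge_seqs Fji ltn_ord => /(_ isT).
  rewrite mem_iota => /= ltj; apply/allP => i; rewrite mem_iota size_edge_seqs => /= lti.
  apply/negP => Fji; have : Ordinal lti \in S by apply/SP; exists j.
  by rewrite S0 inE.
rewrite count_vertices; apply: eq_card => x; rewrite inE.
apply/allP/bigcapP => [h i /SP[j ltj Fji]|h j].
  have := h j; rewrite mem_iota => /(_ ltj)/allP/(_ i).
  by rewrite mem_iota size_edge_seqs Fji ltn_ord mem_edge_seqs => /(_ isT).
rewrite mem_iota => /= ltj; apply/allP => i; rewrite mem_iota size_edge_seqs => /= lti.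
apply/implyP => Fji; rewrite (mem_edge_seqs (Ordinal lti)).
by apply: h; apply/SP; exists j.
Qed.

Lemma helly1_small_core q :
  helly 1 q H = ~~ small_core n es q 1 (fun _ i => q <= \sum_(v <- nth [::] es i) 1).
Proof.
rewrite helly1 (@small_coreE _ _ _ [set i | q <= #|edge (h := H) i|]) // => i.
rewrite inE -size_nth_edge_seqs -sum1_size.
by apply: (iffP idP) => [h|[]//]; exists 0.
Qed.

Variables p q : nat.
Local Notation N := 'C(n, q).
Variable L : nat -> nat -> nat.
Hypothesis p_gt0 : 0 < p.
Hypothesis L_list : forall a, a < N -> combination n q (L a) /\ colex q (L a) = a.

Definition listed_set (a : nat) : {set vertex H} :=
  [set x | index x \in [seq L a k | k <- iota 0 q]].

Lemma card_listed_set a : a < N -> #|listed_set a| = q.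
Proof.
move=> lta; have [[inc lt] _] := L_list lta.
have <- := count_vertices (mem [seq L a k | k <- iota 0 q]).
rewrite -size_filter -[RHS](size_iota 0) -[RHS](size_map (L a)).
apply/perm_size/uniq_perm.
- by rewrite filter_uniq ?iota_uniq.
- rewrite map_inj_in_uniq ?iota_uniq // => i j; rewrite !mem_iota => lti ltj eqL.
  have [ltij|ltji|//] := ltngtP i j.
    by have := @increasing_ltn q _ i j inc; rewrite eqL ltnn; lia.
  by have := @increasing_ltn q _ j i inc; rewrite eqL ltnn; lia.
move=> v; rewrite mem_filter; apply: andb_idr => /mapP[k].
by rewrite !mem_iota => /lt ? ->.
Qed.

(** The sorted indices of [A] and the list stored at their rank are combinations of equal rank,
    hence coincide. *)
Lemma listed_set_surj (A : {set vertex H}) : #|A| = q -> exists2 a, a < N & A = listed_set a.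
Proof.
move=> cA; have [t [ct eA]] := combination_of_set A; rewrite cA in ct eA.
have lta := colex_ltn ct; exists (colex q t) => //; rewrite {1}eA.
have [[inc lt] eqc] := L_list lta; apply/setP => x; rewrite !inE; congr (_ \in _).
apply/eq_in_map => k; rewrite mem_iota => ltk.
by apply: (colex_inj (proj1 ct) inc) => //; rewrite eqc.
Qed.

Lemma containsP t (i : 'I_(nedges H)) : (forall j, j < p -> t j < N) ->
  reflect (forall j, j < p -> listed_set (t j) \subset edge i) (contains p q es L t i).
Proof.
move=> ltt; rewrite /contains.
(* An edge lists each vertex at most once, so exchanging the sums counts the pairs [(j, k)] whose
   vertex lies on the edge. *)
have -> : \sum_(v <- nth [::] es i) multiplicity p q L t v
    = \sum_(j < p) \sum_(k < q) (L (t j) k \in nth [::] es i).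
  rewrite exchange_big; apply: eq_bigr => j _.
  rewrite exchange_big; apply: eq_bigr => k _ /=.
  rewrite -count_uniq_mem ?uniq_edge_seqs // -sum1_count [RHS]big_mkcond.
  by apply: eq_bigr => v _ /=; rewrite eq_sym; case: eqP.
rewrite (leq_sum2_bool p q (fun j k => L (t j) k \in _)).
apply: (iffP forallP) => [h j ltj|h j].
  apply/subsetP => x; rewrite inE => /mapP[k]; rewrite mem_iota => ltk ex.
  rewrite -mem_edge_seqs ex.
  by have /forallP/(_ (Ordinal (ltk : k < q))) := h (Ordinal ltj).
apply/forallP => k; have [[_ lt] _] := L_list (ltt j (ltn_ord j)).
have ltL := lt k (ltn_ord k); have eL : index (enum_val (Ordinal ltL)) = L (t j) k.
  by rewrite enum_valK.
rewrite -eL mem_edge_seqs; apply: (subsetP (h j (ltn_ord j))).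
by rewrite inE eL; apply: map_f; rewrite mem_iota ltn_ord.
Qed.

Lemma helly_counterexample :
  helly p q H <-> forall t, combination N p.+1 t -> ~~ counterexample p n q es L t.
Proof.
rewrite (helly_support p_gt0 card_listed_set listed_set_surj).
have E t : combination N p.+1 t -> counterexample p n q es L t =
    (support p listed_set t != set0) && (#|core (support p listed_set t)| < q).
  move=> ct; have ltt j : j < p.+1 -> forall k, k < p -> skip t j k < N.
    by move=> ltj; case: (combination_skip j ct).
  apply: (@small_coreE q p.+1) => i; rewrite inE; apply: (iffP existsP) => [[j /forallP h]|[j ltj cj]].
    exists j => //; apply/containsP; first exact: ltt.
    by move=> k ltk; apply: (h (Ordinal ltk)).
  exists (Ordinal ltj); apply/forallP => k.
  by move/containsP: cj => -> //; apply: ltt.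
by split=> h t ct; [rewrite E // h | rewrite -E // h].
Qed.

End Listing.

(** * The decision procedure *)

(** The falling factorial, unrolled into a single expression of constant cost because [q] is fixed.
    For [n < q] a truncated factor is 0, as it should be. *)
Fixpoint falling (e : expr) (k : nat) : expr :=
  if k is k'.+1 then falling e k' |*| (e |-| #k') else #1.

Lemma eval_falling s e k : eval s (falling e k) = eval s e ^_ k.
Proof. by elim: k => // k IHk; rewrite ffactnSr -IHk. Qed.

Definition general_case (q : nat) : cmd :=
  list_subsets q;; pascal;; fill_rows q;; check_all q.

(** The same [collect] and [check], with one row only: unit weights and target [q] gather the edges
    of size at least [q] in row 0. *)
Definition single_case (q : nat) : cmd :=
  Assign rV #0;;
  While ($rVert |-| $rV)
    (Write (addr Mult $rV) #1;;
     Assign rV ($rV |+| #1));;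
  Assign rIdx #0;;
  Assign rTarget #q;;
  collect;;
  Write (addr Row #0) #0;;
  Assign rRows #1;;
  Assign rEdge (cell Ptr #0);;
  Assign rAns #1;;
  check q.

(* The base address bounds the length of the input, as [total_size H] is at most
   [n * m]. The second test is [p < 'C(n, q)], without division. *)
Definition helly_program (q : nat) : cmd :=
  Assign rP (Read #0);;
  Assign rVert (Read #1);;
  Assign rEdges (Read #2);;
  Assign rBase (#3 |+| $rEdges |+| $rVert |*| $rEdges);;
  If ($rP |-| #1)
    (If (falling $rVert q |-| $rP |*| #(q`!)) (general_case q) (Assign rAns #1))
    (single_case q).

(** * Correctness of the complete program *)

Section Program.

Variables (p q B : nat) (H : hypergraph).
Variable l : 'I_(nedges H) -> seq (vertex H).
Hypothesis listing : edge_listing l.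

Local Notation n := (nvertices H).
Local Notation m := (nedges H).
Local Notation M := (total_size H).
Local Notation R := (rank H).
Local Notation N := 'C(n, q).
Local Notation es := (edge_seqs l).
Local Notation base := (3 + m + n * m).
Local Notation arr := (contents base).
Local Notation ready := (safe B base).
Local Notation loaded := (loaded base p n es).
Local Notation wp := (runs B).

Let es_uniq := uniq_edge_seqs listing.
Let es_lt := @edge_seqs_lt H l.

Lemma size_edge_seqs_le i : size (nth [::] es i) <= n.
Proof. exact: size_edge. Qed.

Lemma leq_rank i : i < size es -> size (nth [::] es i) <= R.
Proof.
rewrite size_edge_seqs => lti; rewrite (size_nth_edge_seqs listing (Ordinal lti)).
exact: (leq_bigmax (Ordinal lti)).
Qed.

Lemma offset_edge_seqs : offset es (size es) <= base.
Proof.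
rewrite /offset size_edge_seqs -addnA leq_add2l.
apply: (@leq_trans (\sum_(j < m) n.+1)); last by rewrite sum_nat_const card_ord; lia.
by apply: leq_sum => j _; rewrite ltnS size_edge_seqs_le.
Qed.

Lemma sum_edge_seqs : \sum_(i < size es) (2 * size (nth [::] es i)).+1 = 2 * M + m.
Proof.
rewrite size_edge_seqs /total_size big_distrr /= -[m in _ + m]card_ord -sum1_card -big_split.
by apply: eq_bigr => i _ /=; rewrite (size_nth_edge_seqs listing) addn1.
Qed.

Lemma nedges_le : m <= M.
Proof.
rewrite -[X in X <= _]card_ord -sum1_card leq_sum // => i _.
by rewrite card_gt0 edge_neq0.
Qed.

Lemma rank_le : R <= M.
Proof. by apply/bigmax_leqP => i _; rewrite /total_size (bigD1 i) //= leq_addr. Qed.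

Lemma nvertices_le : n <= M.
Proof.
rewrite /nvertices -cardsT -(edge_cover H) /total_size.
elim/big_ind2: _ => // [|a A b C leA leC]; first by rewrite cards0.
by apply: leq_trans (leq_card_setU _ _) _; rewrite leq_add.
Qed.

Lemma size_input : size (input p n es) = offset es (size es).
Proof.
rewrite /input /offset /= size_flatten /shape -map_comp sumnE big_map.
rewrite (big_nth [::]) big_mkord.
by do 3!congr S; apply: eq_bigr => i _ /=.
Qed.

Lemma input_leq a : nth 0 (input p n es) a <= p + n + m.
Proof.
have [lta|gea] := ltnP a (size (input p n es)); last by rewrite nth_default.
have : nth 0 (input p n es) a \in input p n es by apply: mem_nth.
rewrite /input !inE size_edge_seqs => /or4P[/eqP->|/eqP->|/eqP->|]; try lia.
case/flattenP => s /mapP[e ein ->]; have := ein => /(nthP [::])[i lti ei].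
rewrite inE => /predU1P[->|].
  by have := size_edge_seqs_le i; rewrite ei; lia.
by rewrite -{1}ei => /es_lt; lia.
Qed.

Hypothesis q_gt0 : 0 < q.
Hypothesis base_B : base < B.
Hypothesis pnm_B : p + n + m + 1 < B.
Hypothesis q_B : q < B.
Hypothesis pq_B : p * q < B.

Lemma wp_single s0 : p = 1 -> ready s0 -> loaded s0 ->
  (forall k i, arr s0 k i = 0) ->
  wp (single_case q) (fun s => reg s rAns = helly p q H)
    (n * 1 + (2 * M + m) + R * 2) s0.
Proof.
move=> p1 rs0 ld0 zero; have [eP eV eE _] := ld0.
apply: wp_seq0; apply: (wp_assign (v := 0)) => //; first by lia.
apply: (@wp_seq _ (n * 1) (2 * M + m + R * 2)); first by lia.
apply: (wp_while_const base n (fun v s => reg s rV = v /\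
   forall u, arr s Mult u = (u < v))) => //.
- by apply: ready_setr => //; lia.
- by split=> // u; rewrite evalE zero.
- move=> v s lev rs [frr _ _] [ev em]; have [_ eb] := rs.
  split; first by rewrite !evalE ev frr // !evalE /= eV; lia.
  move=> ltv; apply: wp_seq0; apply: (wp_write base (i := v) (v := 1)) => //; first by lia.
  apply: (wp_assign (v := v.+1)); [by rewrite !evalE ev addn1 | by lia |].
  by split=> // u; rewrite !evalE /= em ltnS; case: (ltngtP u v).
move=> s1 rs1 fr1 [_ em]; have [fr1r _ fr1a] := fr1.
have ld1 : loaded s1 by apply: loaded_frame fr1 _ => //.
apply: wp_seq0; apply: (wp_assign (v := 0)) => //; first by lia.
apply: wp_seq0; apply: (wp_assign (v := q)) => //.
set s2 := setr _ _ _.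
have rs2 : ready s2 by do 2!(apply: ready_setr; [by [] | by lia |]).
have ld2 : loaded s2 by do 2!apply: loaded_setr => //.
have mu2 v : v < n -> arr s2 Mult (0 * n + v) = 1 by move=> ltv; rewrite !evalE em ltv.
have cl2 : row_clear base n s2 0.
  by split=> [||v _]; rewrite !evalE fr1a // evalE zero.
have mu_B : \sum_(v < n) 1 < B by rewrite sum1_card card_ord; lia.
apply: (@wp_seq _ (2 * M + m) (R * 2)) => //; rewrite -sum_edge_seqs.
apply: wp_conseq (wp_frame base (erefl : wf collect) rs2 (wp_collect es_uniq es_lt
  offset_edge_seqs base_B rs2 ld2 (erefl : reg s2 rIdx = 0) (erefl : reg s2 rTarget = q)
  mu2 cl2 mu_B)) _.
move=> s3 [rs3 fr3 [row3 _]]; have [_ eb3] := rs3.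
have ld3 : loaded s3 by apply: loaded_frame fr3 ld2.
apply: wp_seq0; apply: (wp_write base (i := 0) (v := 0)) => //; first by lia.
apply: wp_seq0; apply: (wp_assign (v := 1)) => //; first by lia.
have ltP : arr s3 Ptr 0 < B by case: rs3 => -[_ ltM] _; apply: ltM.
apply: wp_seq0; apply: (wp_assign (v := arr s3 Ptr 0)) => //.
  by rewrite (eval_cell base) // !evalE.
apply: wp_seq0; apply: (wp_assign (v := 1)) => //; first by lia.
set s4 := setr _ _ _.
have A4 k i : acode k < 6 -> arr s4 k i = arr s3 k i.
  by rewrite !evalE; case: k.
have rs4 : ready s4.
  do 3!(apply: ready_setr; [by [] | by lia |]); apply: ready_seta => //; lia.
have ld4 : loaded s4 by do 3!apply: loaded_setr => //; apply: loaded_seta.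
pose F := (fun (_ : nat) i => q <= \sum_(v <- nth [::] es i) 1).
have row4 : row_of base n es s4 0 (F 0).
  by case: row3 => eT eC ep; split=> [|v ltv|]; rewrite A4 //; apply: eC.
have rows4 j : j < 1 -> arr s4 Row j = 0 /\ row_of base n es s4 0 (F j).
  by case: j => // _; split=> //; rewrite !evalE.
have edge4 : (reg s4 rEdge = 0 /\ (forall j i, j < 1 -> i < size es -> ~~ F j i))
  \/ (exists j i, [/\ j < 1, i < size es, F j i & reg s4 rEdge = offset es i]).
  have -> : reg s4 rEdge = arr s3 Ptr 0 by [].
  case: row3 => _ _ [[-> nF]|[i [lti Fi ->]]]; [left | right].
    by split=> // j i _; apply: nF.
  by exists 0, i.
have B1 : 1 < B by lia.
apply: wp_conseq (wp_check (I := fun _ => 0) (F := F) (a := true) es_uniq es_lt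
  offset_edge_seqs base_B q rs4 ld4 _ _ rows4 B1 leq_rank edge4) _ => // s5 ->.
by rewrite p1 (helly1_small_core listing).
Qed.

Lemma wp_general s0 : 0 < p < N -> ready s0 -> loaded s0 ->
  (forall k i, arr s0 k i = 0) ->
  N.+1 < B -> 2 * 'C(N, p) < B -> 'C(N, p.+1) < B ->
  wp (general_case q) (fun s => reg s rAns = helly p q H)
    ((q + N * (q * 1 + q).+1) + (((N - p) * 1 + p * ((N - p) * 1).+1) +
     ((p + 'C(N, p) * (p * (q * 1).+1 + (2 * M + m) + p).+1) +
      (p.+1 + 'C(N, p.+1) * ((p * 1 + p * 1) + R * p.+2 + p.+1).+1)))) s0.
Proof.
move=> /andP[p_gt0 ltpN] rs0 ld0 zero N_B X_B Y_B; have n_B : n.+1 < B by lia.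
have lead := offset_edge_seqs.
apply: wp_seq (leqnn _) _.
apply: wp_conseq (wp_frame base (erefl : wf (list_subsets q)) rs0
  (wp_list_subsets base_B q_gt0 p_gt0 ltpN n_B N_B X_B rs0 ld0)) _.
move=> s1 [rs1 fr1 [eN1 list1]]; have [_ _ fr1a] := fr1.
have ld1 : loaded s1 by apply: loaded_frame fr1 ld0.
have zero1 k i : acode k \notin [:: acode Subset; acode Comb] -> arr s1 k i = 0.
  by move=> nk; rewrite fr1a ?zero //; case: k nk.
apply: wp_seq (leqnn _) _.
apply: wp_conseq (wp_frame base (erefl : wf pascal) rs1
  (wp_pascal base_B q_gt0 p_gt0 ltpN n_B N_B X_B rs1 ld1 eN1 _)) _.
  by move=> i; apply: zero1.
move=> s2 [rs2 fr2 tab2]; have [fr2r _ fr2a] := fr2.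
have ld2 : loaded s2 by apply: loaded_frame fr2 ld1.
pose L i k := contents base s1 Subset (i * q + k).
have listL a : a < N -> combination n q (L a) /\ colex q (L a) = a by apply: list1.
have ltL i k : i < N -> k < q -> L i k < n.
  by move=> lti ltk; have [[_ lt] _] := listL i lti; apply: lt.
have ls2 : listed base n q L s2 by move=> i k _ _; rewrite fr2a.
have eN2 : reg s2 rN = N by rewrite fr2r.
have zero2 k i : acode k < 4 -> arr s2 k i = 0.
  by move=> ltk; rewrite fr2a ?zero1 //; case: k ltk.
apply: wp_seq (leqnn _) _; rewrite -sum_edge_seqs.
apply: wp_conseq (wp_frame base (erefl : wf (fill_rows q)) rs2
  (wp_fill_rows base_B q_gt0 p_gt0 ltpN n_B N_B X_B es_uniq es_lt lead pq_B ltL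
     rs2 ld2 ls2 eN2 zero2)) _.
move=> s3 [rs3 fr3 rows3]; have [fr3r _ fr3a] := fr3.
have ld3 : loaded s3 by apply: loaded_frame fr3 ld2.
have eN3 : reg s3 rN = N by rewrite fr3r.
have tab3 : pascal_table base p n q s3 by move=> b a *; rewrite fr3a // tab2.
apply: wp_conseq (wp_check_all base_B q_gt0 p_gt0 ltpN n_B N_B X_B es_uniq es_lt lead pq_B Y_B
     rs3 ld3 eN3 tab3 rows3 leq_rank) _.
move=> s4 [a [-> aP]]; congr nat_of_bool; apply/idP/idP => [/aP h|h].
  exact/(helly_counterexample listing p_gt0 listL).
exact/aP/(helly_counterexample listing p_gt0 listL).
Qed.

Lemma wp_program K : 0 < p ->
  (p = 1 -> n * 1 + (2 * M + m) + R * 2 <= K) ->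
  (1 < p < N -> [/\ N.+1 < B, 2 * 'C(N, p) < B, 'C(N, p.+1) < B &
    (q + N * (q * 1 + q).+1) + (((N - p) * 1 + p * ((N - p) * 1).+1) +
     ((p + 'C(N, p) * (p * (q * 1).+1 + (2 * M + m) + p).+1) +
      (p.+1 + 'C(N, p.+1) * ((p * 1 + p * 1) + R * p.+2 + p.+1).+1))) <= K]) ->
  wp (helly_program q) (fun s => reg s rAns = helly p q H) K
    (initial_state (encode p l)).
Proof.
move=> p_gt0 K1 K2; rewrite (encode_input l p).
apply: wp_seq0; apply: (wp_assign (v := p)) => //; first by lia.
apply: wp_seq0; apply: (wp_assign (v := n)) => //; first by lia.
apply: wp_seq0; apply: (wp_assign (v := m)); [by rewrite /= -(size_edge_seqs l) | by lia |].
apply: wp_seq0; apply: (wp_assign (v := base)) => //.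
set s1 := setr _ _ _.
have rs1 : ready s1.
  split=> //; split=> [x|a]; last by apply: leq_ltn_trans (input_leq a) _; lia.
  by rewrite /s1 !evalE /=; do 4!(case: ifP => _; first by lia); lia.
have ld1 : loaded s1 by split=> //; rewrite size_edge_seqs.
(* The arrays start past the end of the input, where the initial memory has its default value 0. *)
have zero k i : arr s1 k i = 0.
  transitivity (nth 0 (input p n es) (base + (8 * i + acode k))) => //.
  rewrite nth_default // size_input.
  by apply: leq_trans offset_edge_seqs _; apply: leq_addr.
apply: wp_if; rewrite !evalE /= => tp; last first.
  have p1 : p = 1 by lia.
  exact: wp_leq (wp_single p1 rs1 ld1 zero) (K1 p1).
have leN : (p < N) = (p * q`! < n ^_ q).
  by rewrite -bin_ffact ltn_pmul2r ?fact_gt0.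
apply: wp_if; rewrite eval_sub eval_falling !evalE /= => tN.
  have ltN : 1 < p < N by apply/andP; split; [lia | rewrite leN; lia].
  have [N_B X_B Y_B leK] := K2 ltN.
  apply: wp_leq (wp_general _ rs1 ld1 zero N_B X_B Y_B) leK.
  by rewrite p_gt0; case/andP: ltN.
apply: (wp_assign (v := 1)) => //; first by lia.
by rewrite evalE helly_few_subsets // leqNgt leN; lia.
Qed.

End Program.

(** * Time bounds and word size *)

Lemma bin_leq_exp n k : 'C(n, k) <= n ^ k.
Proof.
apply: (@leq_trans (n ^_ k)); first by rewrite -bin_ffact leq_pmulr ?fact_gt0.
elim: k => // k IHk; rewrite ffactnSr expnSr; apply: leq_mul => //.
exact: leq_subr.
Qed.

Lemma program_decides (q : nat) (P : nat -> Prop) (f : nat -> hypergraph -> nat) (c : nat) :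
  0 < q -> (forall p, P p -> 0 < p) ->
  (forall p H, P p ->
     let N := 'C(nvertices H, q) in
     (p = 1 -> nvertices H * 1 + (2 * total_size H + nedges H) + rank H * 2
               <= c * (f p H).+1) /\
     (1 < p < N ->
       [/\ N <= f p H, 'C(N, p) <= f p H, 'C(N, p.+1) <= f p H &
       (q + N * (q * 1 + q).+1) + (((N - p) * 1 + p * ((N - p) * 1).+1) +
        ((p + 'C(N, p) * (p * (q * 1).+1 + (2 * total_size H + nedges H) + p).+1) +
         (p.+1 + 'C(N, p.+1) * ((p * 1 + p * 1) + rank H * p.+2 + p.+1).+1)))
       <= c * (f p H).+1])) ->
  decides_helly_in_time_O (helly_program q) q P f.
Proof.
move=> q_gt0 P_gt0 bound.
(* [c.+1] absorbs the extra portion in [run_exec]. Stored values are kept below [B = W ^ (q + 4)]: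
   the factor [W ^ q] exceeds the constant [q], and four more factors [W] cover values like
   [3 + m + n * m]. Raising [B] to the [width] covers intermediate values. *)
exists (duration (helly_program q) * c.+1), ((q + 4) * width (helly_program q)).
move=> p H l Pp listing; have leM := nedges_le H; set m := nedges H in leM.
set n := nvertices H; set M := total_size H in leM *; set F := f p H.
move eW : (p + n + M + F + 2) => W; rewrite expnM; set B := W ^ (q + 4).
have W_gt1 : 1 < W by lia.
have q_W : q < W ^ q by apply: ltn_expl.
have W4 : B = W ^ q * (W * W * (W * W)) by rewrite /B expnD !expnS expn0 muln1 !mulnA.
have big x : x < W * W * (W * W) -> x < B.
  by move=> lt; rewrite W4; apply: leq_trans lt _; rewrite leq_pmull ?expn_gt0 //; lia.
have WW : 4 * (W * W) <= W * W * (W * W).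
  by rewrite leq_mul2r; apply/orP; right; nia.
have base_B : 3 + m + n * m < B.
  by apply: big; apply: leq_trans WW; nia.
have pnm_B : p + n + m + 1 < B by apply: big; apply: leq_trans WW; nia.
have q_B : q < B.
  by rewrite W4; apply: leq_trans q_W _; rewrite leq_pmulr //; nia.
have pq_B : p * q < B.
  rewrite W4 mulnC; apply: ltn_mul => //; apply: leq_trans WW; nia.
have [K1 K2] := bound p H Pp.
have [|s [k [rn lek es]]] := @wp_program p q B H l listing q_gt0 base_B pnm_B q_B pq_B
  (c * F.+1) (P_gt0 p Pp) K1.
  move=> /K2[N_F X_F Y_F leK]; rewrite -/F in N_F X_F Y_F.
  have W2 : 2 * W <= 4 * (W * W) by rewrite mulnA leq_mul2r; lia.
  by split=> //; apply: big; apply: leq_trans WW; lia.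
have B_gt1 : 1 < B by lia.
have bs : bounded B (initial_state (encode p l)).
  split=> [x|a]; first exact: ltnW.
  rewrite encode_input; apply: (@leq_ltn_trans (p + n + m)); last by lia.
  exact: (input_leq p listing a).
have [t ex let_] := run_exec B_gt1 bs rn (leqnn _).
exists s, t; split=> //; apply: leq_trans let_ _.
by rewrite -mulnA leq_mul2l; apply/orP; right; rewrite mulSn; lia.
Qed.

(** A larger [f] also enlarges the machine words, and a run remains valid with larger words. *)
Lemma decides_leq alg q (P P' : nat -> Prop) (f f' : nat -> hypergraph -> nat) :
  (forall p, P' p -> P p) -> (forall p H, P' p -> f p H <= f' p H) ->
  decides_helly_in_time_O alg q P f -> decides_helly_in_time_O alg q P' f'.
Proof.
move=> imp lef [c [d dec]]; exists c, d => p H l Pp listing.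
have [s [t [ex es let_]]] := dec p H l (imp p Pp) listing; exists s, t; split=> //.
  apply: exec_leq ex; case: (d) => // d'.
  by rewrite leq_exp2r // leq_add2r leq_add2l lef.
by apply: leq_trans let_ _; rewrite leq_mul2l ltnS lef ?orbT.
Qed.

(** All terms are compared with [F] through [N * X <= F], where [0 < R] is used, and [M * X <= F].
    Factors [p] are absorbed by [p < N], and [Y] by [p.+1 * Y = (N - p) * X]. The first three bounds
    serve the word size, as the counters reach [N], [X] and [Y]. *)
Lemma general_bound N p q R M m (X := 'C(N, p)) (Y := 'C(N, p.+1)) :
  1 < p < N -> 0 < R -> m <= M ->
  [/\ N <= (R * N + M) * X, X <= (R * N + M) * X, Y <= (R * N + M) * X &
   (q + N * (q * 1 + q).+1) + (((N - p) * 1 + p * ((N - p) * 1).+1) +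
   ((p + X * (p * (q * 1).+1 + (2 * M + m) + p).+1) +
    (p.+1 + Y * ((p * 1 + p * 1) + R * p.+2 + p.+1).+1)))
   <= (4 * q + 16) * ((R * N + M) * X).+1].
Proof.
move=> /andP[p_gt1 ltpN] R_gt0 lemM; set F := (R * N + M) * X.
have ltpX : p < X.
  by apply: (@leq_trans 'C(p.+1, p)); [rewrite binSn | apply: leq_bin2l].
have Y_eq : p.+1 * Y = (N - p) * X by rewrite /Y mul_bin_left.
have NX_F : R * (N * X) <= F by rewrite /F mulnA leq_mul2r leq_addr orbT.
have NX : N * X <= F by apply: leq_trans NX_F; rewrite leq_pmull.
have MX : M * X <= F by rewrite /F leq_mul2r leq_addl orbT.
have N_F : N <= F by apply: leq_trans NX; rewrite leq_pmulr //; lia.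
have X_F : X <= F by apply: leq_trans NX; rewrite leq_pmull //; lia.
have pY : p.+1 * Y <= N * X by rewrite Y_eq leq_mul2r leq_subr orbT.
have RpY : R * (p.+1 * Y) <= F by apply: leq_trans NX_F; rewrite leq_mul2l pY orbT.
have Y_F : Y <= F by apply: leq_trans NX; apply: leq_trans pY; rewrite leq_pmull.
split=> //.
have t1 : q + N * (q * 1 + q).+1 <= (3 * q + 1) * F.
  by apply: (@leq_trans ((3 * q + 1) * N)); [nia | rewrite leq_mul2l N_F orbT].
have t2 : (N - p) * 1 + p * ((N - p) * 1).+1 <= 2 * F.
  have : p * N <= F by apply: leq_trans NX; rewrite mulnC leq_mul2l; lia.
  have : p * (N - p).+1 <= p * N by rewrite leq_mul2l; lia.
  lia.
have t3 : p + X * (p * (q * 1).+1 + (2 * M + m) + p).+1 <= (q + 7) * F.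
  have pX : X * p <= F by apply: leq_trans NX; rewrite mulnC leq_mul2r; lia.
  have -> : p + X * (p * (q * 1).+1 + (2 * M + m) + p).+1
    = p + (X * p) * q + 2 * (X * p) + 2 * (M * X) + m * X + X by lia.
  have mX : m * X <= M * X by rewrite leq_mul2r lemM orbT.
  have : X * p * q <= F * q by rewrite leq_mul2r pX orbT.
  lia.
have t4 : p.+1 + Y * ((p * 1 + p * 1) + R * p.+2 + p.+1).+1 <= 6 * F.
  have -> : Y * ((p * 1 + p * 1) + R * p.+2 + p.+1).+1
    = 2 * (p.+1 * Y) + p * Y + R * (p.+1 * Y) + R * Y by lia.
  have RY : R * Y <= R * (p.+1 * Y) by rewrite leq_mul2l leq_pmull ?orbT.
  lia.
(* The four phases contribute [3 * q + 1], [2], [q + 7] and [6], which makes [4 * q + 16]. *)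
lia.
Qed.

Theorem theorem2p10 (q : nat) (q_gt0 : 0 < q) :
  exists alg : cmd,
    [/\ decides_helly_in_time_O alg q (fun p => p = 1)
          (fun _ H => total_size H),
        decides_helly_in_time_O alg q (fun p => 2 <= p)
          (fun p H => let N := 'C(nvertices H, q) in
             (rank H * N + total_size H) * 'C(N, p))
      & forall p0 : nat, 2 <= p0 ->
        decides_helly_in_time_O alg q (fun p => p = p0)
          (fun p H => rank H * nvertices H ^ ((p + 1) * q)
                      + total_size H * nvertices H ^ (p * q))].
Proof.
have general : decides_helly_in_time_O (helly_program q) q (fun p => 2 <= p)
    (fun p H => let N := 'C(nvertices H, q) in
       (rank H * N + total_size H) * 'C(N, p)).
  apply: (@program_decides _ _ _ (4 * q + 16)) => // [p|p H p_gt1 N]; first exact: ltnW.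
  split=> [p1|ltpN]; first by rewrite p1 in p_gt1.
  apply: general_bound => //; last exact: nedges_le.
  (* [p < N] fails without vertices since [q > 0]; a vertex lies in some edge, so the rank is
     positive. *)
  have /card_gt0P[x _] : 0 < nvertices H.
    rewrite lt0n; apply/eqP => n0; move: ltpN; rewrite /N n0.
    by case: (q) q_gt0 => // q' _; rewrite bin0n andbF.
  have : x \in \bigcup_i edge (h := H) i by rewrite edge_cover inE.
  case/bigcupP => i _ xi; apply: (@leq_trans #|edge (h := H) i|).
    by rewrite card_gt0; apply/set0Pn; exists x.
  exact: (leq_bigmax i).
exists (helly_program q); split=> //.
  (* As [n], [m] and the rank [r] are at most [M], the iteration count [n + 2M + m + 2r] is at most
     [6M]. *)
  apply: (@program_decides _ _ _ 6) => // [p ->//|p H ->]; split=> // _.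
  have := nvertices_le H; have := nedges_le H; have := rank_le H; lia.
move=> p0 p0_gt1; apply: decides_leq general => [p ->//|p H ep /=].
set n := nvertices H; set N := 'C(n, q).
have leN : N <= n ^ q := bin_leq_exp n q.
have leX : 'C(N, p) <= n ^ (p * q).
  by apply: leq_trans (bin_leq_exp N p) _; rewrite mulnC expnM leq_exp2r ?leN //; lia.
rewrite mulnDl; apply: leq_add; last by rewrite leq_mul2l leX orbT.
rewrite -mulnA leq_mul2l addn1 mulSn expnD; apply/orP; right.
exact: leq_mul.
Qed.
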